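(* Let $F:\mathbb{R}^N\to\mathbb{R}$ be uniformly continuous and bounded, and let $\mathcal{D}\subset\mathbb{R}^N$ be open and bounded. Let $J\subset(0,\infty)$ be a sequence converging to $0$ and, for each $\epsilon\in J$, let $u_\epsilon:\mathbb{R}^N\to\mathbb{R}$ be the bounded Borel solution of $$u_\epsilon=\mathcal{A}_\epsilon u_\epsilon\ \text{ in }\mathcal{D},\qquad u_\epsilon=F\ \text{ in }\mathbb{R}^N\setminus\mathcal{D}.$$ Assume that $u_\epsilon$ converges, as $\epsilon\to0$, $\epsilon\in J$, uniformly on $\mathbb{R}^N$ to some continuous function $u\in C(\mathbb{R}^N)$. Then for every $x\in\mathcal{D}$, $r>0$ and every $\phi\in C^2(\mathbb{R}^N)$ such that $\phi(x)=u(x)$ and $\nabla\phi(x)\ne0$, we have: (i) if $\phi>u$ on $\bar B_r(x)\setminus\{x\}$, then $\mathcal{L}_{s,\mathbf p}[\tilde\phi](x)\ge0$; (ii) if $\phi<u$ on $\bar B_r(x)\setminus\{x\}$, then $\mathcal{L}_{s,\mathbf p}[\tilde\phi](x)\le0$, where $\tilde\phi=\mathbf 1_{\bar B_r(x)}\cdot\phi+\mathbf 1_{\mathbb{R}^N\setminus\bar B_r(x)}\cdot u$.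
   Context: Fix an integer $N\ge 2$, $\mathbf p\in[2,\infty)$ and $s\in(\frac12,1)$. $B_r(x)$ is the open ball, $e_1,e_2,\dots$ the standard basis of $\mathbb{R}^N$, $\angle(y,z)$ the angle between vectors. $\mathrm{d}\mu_s^N(z)=\frac{C(N,s)}{|z|^{N+2s}}\,\mathrm{d}z$ with $C(N,s)=\frac{4^s s\,\Gamma(\frac N2+s)}{\pi^{N/2}\Gamma(1-s)}$. Let $\alpha_{\mathbf p}\in(0,\frac\pi2]$ be the angle such that, with $A_{\mathbf p}=\{|z|=1:\ \angle(e_1,z)<\alpha_{\mathbf p}\}$ and $\sigma$ the surface measure on the unit sphere, $\mathbf p-1=\int_{A_{\mathbf p}}\langle z,e_1\rangle^2\,\mathrm{d}\sigma(z)\big/\int_{A_{\mathbf p}}\langle z,e_2\rangle^2\,\mathrm{d}\sigma(z)$. For $0\le a\le b\le\infty$ and $|y|=1$ let $T_{\mathbf p}^{a,b}(y)=\{z\in\mathbb{R}^N:\ \angle(y,z)<\alpha_{\mathbf p},\ a<|z|<b\}$. For bounded Borel $u$ and $\epsilon>0$ define $$\mathcal{A}_\epsilon u(x)=\frac12\Big(\sup_{|y|=1}⨍_{T_{\mathbf p}^{\epsilon,\infty}(y)}u(x+z)\,\mathrm{d}\mu_s^N(z)+\inf_{|y|=1}⨍_{T_{\mathbf p}^{\epsilon,\infty}(y)}u(x+z)\,\mathrm{d}\mu_s^N(z)\Big),$$ where $⨍_T f\,\mathrm{d}\mu_s^N=\frac{1}{\mu_s^N(T)}\int_T f\,\mathrm{d}\mu_s^N$.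 The boundary value problem for $u_\epsilon$ has exactly one bounded Borel solution. For a bounded Borel $v$ that is $C^2$ near $x$ with $p_x=\nabla v(x)\ne0$ define $$\mathcal{L}_{s,\mathbf p}[v](x)=\int_{T_{\mathbf p}^{0,\infty}(p_x/|p_x|)}\big(v(x+z)+v(x-z)-2v(x)\big)\,\mathrm{d}\mu_s^N(z).$$ *)

(* Defs.v *)
From HB Require Import structures.
From mathcomp Require Import all_boot all_order all_algebra.
From mathcomp Require Import all_classical all_reals all_analysis.
From mathcomp Require Import measurable_realfun.

Set Implicit Arguments.
Unset Strict Implicit.
Unset Printing Implicit Defensive.

Import Order.TTheory GRing.Theory Num.Theory.
Import numFieldNormedType.Exports.

Local Open Scope classical_set_scope.
Local Open Scope ring_scope.

(* R^n is 'rV[R]_n. The library norm on matrices is the sup norm: it is used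
   only through the topology, the uniform structure and boundedness, which do
   not depend on the choice of a norm. Lengths and angles use dotr and enorm. *)

Notation borelR R n := (g_sigma_algebraType (@open ('rV[R]_n))).

Section Euclidean.
Context {R : realType} {n : nat}.
Implicit Types (x y z : 'rV[R]_n).

Definition dotr x y : R := \sum_(i < n) x 0 i * y 0 i.
Definition enorm x : R := Num.sqrt (dotr x x).
Definition ecball x (r : R) : set 'rV[R]_n := [set y | enorm (y - x) <= r].
Definition usphere : set 'rV[R]_n := [set y | enorm y = 1].

(* only meaningful for nonzero arguments *)
Definition angle y z : R := acos (dotr y z / (enorm y * enorm z)).

(* 0-based: ebasis 0 is e_1, ebasis 1 is e_2 *)
Definition ebasis (k : nat) : 'rV[R]_n := \row_(j < n) (j == k :> nat)%:R.

Definition partial (i : 'I_n) (f : 'rV[R]_n -> R) : 'rV[R]_n -> R :=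
  fun x => 'D_(ebasis i) f x.

Definition grad (f : 'rV[R]_n -> R) x : 'rV[R]_n := \row_(i < n) partial i f x.

Definition is_C1 (f : 'rV[R]_n -> R) : Prop := forall i : 'I_n,
  (forall x, derivable f x (ebasis i)) /\ continuous (partial i f).

Definition is_C2 (f : 'rV[R]_n -> R) : Prop :=
  is_C1 f /\ forall i : 'I_n, is_C1 (partial i f).

End Euclidean.

Section BorelMeasurability.
Context {R : realType}.

Lemma measurable_rV d (T : measurableType d) n (f : T -> 'rV[R]_n) :
  (forall i, measurable_fun [set: T] (fun t => f t 0 i)) ->
  measurable_fun [set: T] (f : T -> borelR R n).
Proof.
move=> mf; apply: (@measurability _ _ _ (borelR R n) _ _ (@open 'rV[R]_n)) => //.
move=> _ [U oU <-]; rewrite setTI.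
pose B (qm : 'rV[rat]_n * nat) : set 'rV[R]_n :=
  [set v | forall i, `|v 0 i - ratr (qm.1 0 i)| < qm.2.+1%:R^-1].
pose A k : set T :=
  if @pickle_inv ('rV[rat]_n * nat)%type k is Some qm then
    if `[< B qm `<=` U >] then f @^-1` B qm else set0
  else set0.
have -> : f @^-1` U = \bigcup_k A k.
  apply/seteqP; split => [t /= Uft|t [k _]]; last first.
    rewrite /A; case: pickle_inv => // qm.
    by case: asboolP => // BU; exact: BU.
  have /nbhs_ballP[e e0 eU] : nbhs (f t) U by exact: open_nbhs_nbhs.
  have [m me] : exists m : nat, m.+1%:R^-1 < e / 2.
    have e20 : 0 < e / 2 by rewrite divr_gt0.
    exists (Num.truncn (e / 2)^-1).
    rewrite -[ltRHS]invrK ltf_pV2 ?posrE ?invr_gt0//.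
    exact: truncnS_gt.
  have q_ i : exists q : rat, `|f t 0 i - ratr q| < m.+1%:R^-1.
    have /rat_in_itvoo[q] : f t 0 i - m.+1%:R^-1 < f t 0 i + m.+1%:R^-1.
      by rewrite ltrD2l gtrN// invr_gt0.
    by rewrite in_itv/= -ltr_distl distrC => qf; exists q.
  pose q := \row_i sval (cid (q_ i)).
  have BU : B (q, m) `<=` U.
    move=> v /= Bv; apply: eU; split => // i j; rewrite (ord1 i).
    rewrite /ball/= -(subrKA (ratr (q 0 j))).
    rewrite (le_lt_trans (ler_normD _ _))// (splitr e) ltrD//.
      by apply: lt_trans me; rewrite mxE; case: cid.
    by rewrite distrC; exact: lt_trans (Bv j) me.
  exists (pickle (q, m)) => //; rewrite /A pickleK_inv.
  case: asboolP => // _ i /=.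
  by rewrite mxE; case: cid.
apply: bigcupT_measurable => k; rewrite /A.
case: pickle_inv => [qm|]; last exact: measurable0.
case: asboolP => _; last exact: measurable0.
rewrite (_ : f @^-1` _ = \bigcap_(i : 'I_n)
  [set t | `|f t 0 i - ratr (qm.1 0 i)| < qm.2.+1%:R^-1]); last first.
  by apply/seteqP; split => [t H i _|t H i]; exact: H.
apply: fin_bigcap_measurable => // i _.
rewrite (_ : mkset _ = [set: T] `&` (fun t => f t 0 i) @^-1`
    `]ratr (qm.1 0 i) - qm.2.+1%:R^-1, ratr (qm.1 0 i) + qm.2.+1%:R^-1[).
  by apply: mf => //; exact: measurable_itv.
by rewrite setTI; apply/seteqP; split => t /=; rewrite in_itv/= ltr_distl.
Qed.

Lemma measurable_coord n (i : 'I_n) :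
  measurable_fun [set: borelR R n] (fun v : 'rV[R]_n => v 0 i).
Proof.
apply: (measurability (@RGenOInfty.G R)).
  exact: RGenOInfty.measurableE.
move=> _ [_ [x ->] <-]; rewrite setTI; apply: sub_sigma_algebra.
have /continuousP := @coord_continuous R 1 n 0 i; apply.
by rewrite set_itvE; exact: open_gt.
Qed.

End BorelMeasurability.

Section LebesgueStep.
Context {R : realType} {n : nat}.
Variable m : {sigma_finite_measure set (borelR R n) -> \bar R}.

Definition consrV (p : R * 'rV[R]_n) : 'rV[R]_n.+1 := row_mx p.1%:M p.2.

Definition lebesgue_step : set (borelR R n.+1) -> \bar R :=
  fun A => (lebesgue_measure \x m)%E (consrV @^-1` A).

Let measurable_consrV : measurable_fun [set: measurableTypeR R * borelR R n]
  (consrV : _ -> borelR R n.+1).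
Proof.
apply: measurable_rV => i.
case: (splitP (i : 'I_(1 + n))) => j ij.
  rewrite (_ : (fun t => _) = fst)//.
  apply/funext => -[x v]; rewrite /consrV (_ : i = lshift n j); last exact: val_inj.
  by rewrite (row_mxEl (x%:M : 'rV_1)) mxE ord1 eqxx.
rewrite (_ : (fun t => _) = (fun v : 'rV[R]_n => v 0 j) \o snd).
  exact: (measurableT_comp (@measurable_coord R n j) measurable_snd).
apply/funext => -[x v]; rewrite /consrV (_ : i = rshift 1 j); last exact: val_inj.
by rewrite /= (row_mxEr (x%:M : 'rV_1)).
Qed.

Let lebesgue_step0 : lebesgue_step set0 = 0%E.
Proof. by rewrite /lebesgue_step preimage_set0 measure0. Qed.

Let lebesgue_step_ge0 A : (0 <= lebesgue_step A)%E.
Proof. exact: measure_ge0. Qed.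

Let lebesgue_step_sigma_additive : semi_sigma_additive lebesgue_step.
Proof.
move=> F mF tF mUF; rewrite /lebesgue_step preimage_bigcup.
apply: measure_semi_sigma_additive.
- by move=> k; rewrite -[X in measurable X]setTI; exact: measurable_consrV.
- apply/trivIsetP => /= i j _ _ ij; rewrite -preimage_setI.
  by move/trivIsetP : tF => /(_ _ _ _ _ ij) ->//; rewrite preimage_set0.
- rewrite -preimage_bigcup -[X in measurable X]setTI.
  exact: measurable_consrV.
Qed.

HB.instance Definition _ := isMeasure.Build _ _ _ lebesgue_step
  lebesgue_step0 lebesgue_step_ge0 lebesgue_step_sigma_additive.

Let lebesgue_step_sigma_finite : sigma_finite setT lebesgue_step.
Proof.
have /sigma_finiteP[F [FT ndF mF]] := sigma_finiteT (@lebesgue_measure R).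
have /sigma_finiteP[H [HT ndH mH]] := sigma_finiteT m.
pose G k := F k `*` H k.
have GT : setT = \bigcup_k G k.
  rewrite -setXTT FT HT; apply/seteqP; split => [[x v] /=|[x v] [k _ [/= Fx Hv]]].
    move=> [[i _ Fx] [j _ Hv]]; exists (maxn i j) => //; split => /=.
      by move: x Fx; exact/subsetPset/ndF/leq_maxl.
    by move: v Hv; exact/subsetPset/ndH/leq_maxr.
  by split; exists k.
have mG k : measurable (G k) /\ ((lebesgue_measure \x m) (G k) < +oo)%E.
  have [mFk Fk] := mF k; have [mHk Hk] := mH k.
  split; first exact: measurableX.
  by rewrite product_measure1E// lte_mul_pinfty// ge0_fin_numE.
pose uncons (v : 'rV[R]_n.+1) : R * 'rV[R]_n :=
  (v 0 ord0, \row_j v 0 (lift ord0 j)).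
have unconsK p : uncons (consrV p) = p.
  case: p => x v; rewrite /uncons /consrV; congr pair.
    transitivity (row_mx (x%:M : 'rV_1) v 0 (lshift n 0)).
      by congr (row_mx _ _ _ _); exact: val_inj.
    by rewrite row_mxEl mxE eqxx.
  apply/rowP => j; rewrite mxE.
  transitivity (row_mx (x%:M : 'rV_1) v 0 (rshift 1 j)).
    by congr (row_mx _ _ _ _); exact: val_inj.
  by rewrite row_mxEr.
have muncons : measurable_fun [set: borelR R n.+1]
    (uncons : _ -> measurableTypeR R * borelR R n).
  apply/measurable_fun_pairP; split => /=; first exact: measurable_coord.
  apply: measurable_rV => i; under eq_fun do rewrite mxE.
  exact: measurable_coord.
exists (fun k => uncons @^-1` G k).
  by rewrite -preimage_bigcup -GT preimage_setT.
move=> k; have [mGk Gk] := mG k; split.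
  by rewrite -[X in measurable X]setTI; exact: muncons.
rewrite /lebesgue_step -comp_preimage (_ : uncons \o consrV = id)//.
by apply/funext => p; exact: unconsK.
Qed.

HB.instance Definition _ := Measure_isSigmaFinite.Build _ _ _ lebesgue_step
  lebesgue_step_sigma_finite.

End LebesgueStep.

(* N-dimensional Lebesgue measure on the Borel sets of R^N, as an iterated
   product of the one-dimensional one *)
Fixpoint lebesgue_rV (R : realType) (n : nat) :
    {sigma_finite_measure set (borelR R n) -> \bar R} :=
  match n with
  | 0 => \d_((0 : 'rV[R]_0) : borelR R 0)
  | n'.+1 => lebesgue_step (lebesgue_rV R n')
  end.

Lemma lebesgue_rV_box (R : realType) n (A : 'I_n -> set (measurableTypeR R)) :
  (forall i, measurable (A i)) ->
  lebesgue_rV R n [set v | forall i, A i ((v : 'rV[R]_n) 0 i)] =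
  \big[mule/1%E]_(i < n) lebesgue_measure (A i).
Proof.
elim: n A => [|n IH] A mA.
  by rewrite big_ord0 /= diracE mem_set// => -[].
rewrite big_ord_recl -IH; last by move=> i; exact: mA.
have mB : measurable
    ([set v | forall i, A (lift ord0 i) ((v : 'rV[R]_n) 0 i)] : set (borelR R n)).
  rewrite (_ : mkset _ = \bigcap_(i : 'I_n) ([set: borelR R n] `&`
      (fun v : 'rV[R]_n => v 0 i) @^-1` A (lift ord0 i))).
    apply: fin_bigcap_measurable => // i _.
    by apply: measurable_coord => //; exact: mA.
  by apply/seteqP; split => [v Av i _|v Av i]; [split => //; exact: Av|
     by have [] := Av i I].
rewrite -product_measure1E//= /lebesgue_step; congr (product_measure1 _ _ _).
have cons0 x (v : 'rV[R]_n) : consrV (x, v) 0 ord0 = x.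
  transitivity (row_mx (x%:M : 'rV_1) v 0 (lshift n 0)).
    by congr (row_mx _ _ _ _); exact: val_inj.
  by rewrite row_mxEl mxE eqxx.
have consS x (v : 'rV[R]_n) j : consrV (x, v) 0 (lift ord0 j) = v 0 j.
  transitivity (row_mx (x%:M : 'rV_1) v 0 (rshift 1 j)).
    by congr (row_mx _ _ _ _); exact: val_inj.
  by rewrite row_mxEr.
apply/seteqP; split => [[x v] /= Av|[x v] /= [A0 AS] i].
  split; first by rewrite -(cons0 x v); exact: Av.
  by move=> j; rewrite -(consS x v); exact: Av.
by case: (unliftP ord0 i) => [j ->|->]; rewrite ?consS// cons0.
Qed.

Section SurfaceMeasure.
Context {R : realType} {n : nat}.

Definition radial_proj (z : 'rV[R]_n) : 'rV[R]_n := (enorm z)^-1 *: z.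

(* sigma(A) = n * |{ z : 0 < |z| <= 1, z / |z| in A }|: the surface measure of
   the unit sphere, seen as a Borel measure on R^n carried by the sphere *)
Definition surface_measure : set (borelR R n) -> \bar R := fun A =>
  (n%:R%:E * lebesgue_rV R n
     ([set z | (0 < enorm z <= 1)%R] `&` radial_proj @^-1` A))%E.

Lemma measurable_enorm : measurable_fun [set: borelR R n] (@enorm R n).
Proof.
apply: (measurableT_comp (continuous_measurable_fun (@sqrt_continuous R))).
apply: measurable_sum => i.
by apply: measurable_funM; exact: measurable_coord.
Qed.

Let measurable_radial_proj :
  measurable_fun [set: borelR R n] (radial_proj : _ -> borelR R n).
Proof.
apply: measurable_rV => i.
rewrite (_ : (fun t => _) =
    (fun z : borelR R n => enorm z `^ (-1) * (z : 'rV[R]_n) 0 i)).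
  apply: measurable_funM; last exact: measurable_coord.
  exact: (measurableT_comp (measurable_powR (-1)) measurable_enorm).
by apply/funext => z; rewrite mxE powR_inv1// sqrtr_ge0.
Qed.

Let mpunctured_ball :
  measurable ([set z | 0 < enorm z <= 1] : set (borelR R n)).
Proof.
rewrite (_ : mkset _ = [set: borelR R n] `&` @enorm R n @^-1` `]0, 1]).
  by apply: measurable_enorm => //; exact: measurable_itv.
by rewrite setTI; apply/seteqP; split => z /=; rewrite in_itv.
Qed.

Let surface_measure0 : surface_measure set0 = 0%E.
Proof. by rewrite /surface_measure preimage_set0 setI0 measure0 mule0. Qed.

Let surface_measure_ge0 A : (0 <= surface_measure A)%E.
Proof. by rewrite mule_ge0// lee_fin. Qed.

Let surface_measure_sigma_additive : semi_sigma_additive surface_measure.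
Proof.
move=> F mF tF mUF; rewrite /surface_measure preimage_bigcup setI_bigcupr.
have mS (A : set (borelR R n)) : measurable A -> measurable ([set z | 0 < enorm z <= 1] `&`
    radial_proj @^-1` A : set (borelR R n)).
  move=> mA; apply: measurableI => //.
  by rewrite -[X in measurable X]setTI; exact: measurable_radial_proj.
have := @measure_semi_sigma_additive _ _ _ (mscale n%:R%:nng (lebesgue_rV R n))
  (fun k => [set z | 0 < enorm z <= 1] `&` radial_proj @^-1` F k).
apply.
- by move=> k; exact: mS.
- apply/trivIsetP => /= i j _ _ ij.
  apply/seteqP; split => // z [[_ Fi] [_ Fj]].
  have : (F i `&` F j) (radial_proj z) by [].
  by move/trivIsetP : tF => /(_ _ _ _ _ ij) ->.
- by rewrite -setI_bigcupr -preimage_bigcup; exact: mS.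
Qed.

HB.instance Definition _ := isMeasure.Build _ _ _ surface_measure
  surface_measure0 surface_measure_ge0 surface_measure_sigma_additive.

End SurfaceMeasure.

Section Cones.
Context {R : realType} (N : nat).
Implicit Types (alpha a : R) (y z : 'rV[R]_N).

Definition sphere_cap alpha : set 'rV[R]_N :=
  usphere `&` [set z | angle (ebasis 0) z < alpha].

(* alpha is the opening angle alpha_p attached to the exponent p *)
Definition is_alpha (p alpha : R) : Prop :=
  0 < alpha <= pi / 2 /\
  p - 1 = (\int[@surface_measure R N]_(z in sphere_cap alpha) dotr z (ebasis 0) ^+ 2)
        / (\int[@surface_measure R N]_(z in sphere_cap alpha) dotr z (ebasis 1) ^+ 2).

Definition cone alpha (a b : \bar R) y : set 'rV[R]_N :=
  [set z | angle y z < alpha /\ (a < (enorm z)%:E < b)%E].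

End Cones.
Arguments sphere_cap {R N}.
Arguments cone {R N}.

Section Operators.
Context {R : realType} {N : nat}.
Variables (s alpha : R).
Implicit Types (T : set 'rV[R]_N) (f v : 'rV[R]_N -> R) (x y z : 'rV[R]_N).

Definition Gamma (t : R) : R :=
  \int[lebesgue_measure]_(w in `]0%R, +oo[) (w `^ (t - 1) * expR (- w)).

Definition CNs : R :=
  (4 `^ s * s * Gamma (N%:R / 2 + s)) / (pi `^ (N%:R / 2) * Gamma (1 - s)).

Definition mu_density z : R := CNs / enorm z `^ (N%:R + 2 * s).

(* the Levy measure mu_s is only used through its density with respect to
   Lebesgue measure: mu_int T f is the integral of f over T against mu_s,
   and mu_int T (cst 1) is mu_s(T) *)
Definition mu_int T f : R :=
  \int[lebesgue_rV R N]_(z in T) (f z * mu_density z).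

Definition mu_avg T f : R := (mu_int T (cst 1))^-1 * mu_int T f.

Definition avg_op (eps : R) f x : R :=
  2^-1 *
  (sup [set mu_avg (cone alpha eps%:E +oo%E y) (fun z => f (x + z)) | y in usphere]
 + inf [set mu_avg (cone alpha eps%:E +oo%E y) (fun z => f (x + z)) | y in usphere]).

Definition L_op v x : R :=
  mu_int (cone alpha 0%E +oo%E ((enorm (grad v x))^-1 *: grad v x))
    (fun z => v (x + z) + v (x - z) - 2 * v x).

Definition bvp_solution (D : set 'rV[R]_N) (F : 'rV[R]_N -> R) (eps : R)
    (u : 'rV[R]_N -> R) : Prop :=
  [/\ measurable_fun [set: borelR R N] (u : borelR R N -> R),
      bounded_fun u,
      (forall x, D x -> u x = avg_op eps u x)
    & (forall x, ~ D x -> u x = F x)].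

End Operators.

(* Main.v *)
Require Import Defs.
From mathcomp Require Import all_boot all_order all_algebra.
From mathcomp Require Import all_classical all_reals all_analysis.
From mathcomp Require Import measurable_realfun ring lra.

Set Implicit Arguments.
Unset Strict Implicit.
Unset Printing Implicit Defensive.

Import Order.TTheory GRing.Theory Num.Theory.
Import numFieldNormedType.Exports.

Local Open Scope classical_set_scope.
Local Open Scope ring_scope.

(** By replacing u, phi and the u_eps by their opposites, the second inequality
    follows from the first, so let phi touch u strictly from above at x. Write
    p for the gradient of phi at x, e = p / |p|, phit for the glued function,
    and T(a, y) for the cone of axis y with the ball of radius a removed.

    Contact. As u_eps is uniformly close to u, near-maximum points x_eps of
    u_eps - phi on the closed ball converge to x ([near_max_cvg]), and at such
    points the increments u_eps(x_eps + z) - u_eps(x_eps) are at most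
    phit(x_eps + z) - phi(x_eps), up to a tolerance chosen small against the
    mass of T(eps, y) and up to an error supported away from z = 0, where the
    Levy measure is finite.

    Equation. In u_eps(x_eps) = A_eps u_eps(x_eps) let y_eps almost realize the
    supremum. Since every v bounds the infimum from above, the integrals of
    the increments over T(eps, y_eps) and T(eps, v) have a sum that is at least
    - o(1), for every unit v ([avg_op_near_sup]), and by the previous point
    this passes to the increments of phit ([touching_above]).

    Direction. The integral of an increment of phit over T(eps, y) is
    the inner product of grad phi(x_eps) and y times the first moment of
    T(eps, e), plus a bounded error ([glued_expansion]). For s > 1/2 that
    moment tends to infinity ([moment_diverges]), so the choice v = - e forces
    y_eps to converge to e ([direction_cvg]).

    Limit. With v = - y_eps the two integrals combine into the integral over
    T(eps, y_eps) of second differences of phit, which are bounded by a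
    multiple of min(|z|^2, 1), an integrable function for the Levy measure
    ([integrable_levy_weight]). A rotation close to the identity carries
    T(eps, y_eps) to T(eps, e), and dominated convergence gives that L[phit](x)
    is at least 0 ([mu_int_second_difference_ge0]).

    The measure theory behind this is invariance of Lebesgue measure under
    isometries and its homogeneity. Both come from the fact that an
    image of Lebesgue measure under a linear bijection is a multiple of it
    ([lebesgue_rV_comparison]). Homogeneity makes the integrals of powers of |z|
    over dyadic shells geometric sequences, which decides their convergence
    ([selfsimilar_ltry], [selfsimilar_ge]). *)

(** * Lebesgue measure under linear maps *)

Section LebesgueInvariance.
Context {R : realType}.

Lemma lebesgue_measure_shift (a : R) (A : set (measurableTypeR R)) :
  measurable A -> lebesgue_measure ((fun x : R => x + a) @^-1` A) =
                  lebesgue_measure A.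
Proof.
have mf : measurable_fun [set: measurableTypeR R]
    ((fun x => x + a) : measurableTypeR R -> measurableTypeR R).
  exact: measurable_funD.
move=> mA; apply/esym.
have := @lebesgue_measure_unique R
  (measure_function_pushforward__canonical__measure_function_Measure lebesgue_measure mf).
apply => //= X [[b c] _ <-].
rewrite /pushforward (_ : _ @^-1` _ = `]b - a, c - a]%classic); last first.
  by apply/seteqP; split => x /=; rewrite !in_itv/= ltrBlDr lerBrDr.
rewrite !lebesgue_measure_itv/= !lte_fin ltrD2r; case: ifPn => // _.
by rewrite -!EFinD opprB; congr EFin; ring.
Qed.

Lemma measurable_funDV d (T : measurableType d) n (f g : T -> 'rV[R]_n) :
  measurable_fun setT (f : T -> borelR R n) ->
  measurable_fun setT (g : T -> borelR R n) ->
  measurable_fun setT ((fun t => f t + g t) : T -> borelR R n).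
Proof.
move=> mf mg; apply: measurable_rV => i; under eq_fun do rewrite mxE.
by apply: measurable_funD;
  [exact: (measurableT_comp (@measurable_coord R n i) mf)
  |exact: (measurableT_comp (@measurable_coord R n i) mg)].
Qed.

Lemma measurable_shiftrV n (a : 'rV[R]_n) :
  measurable_fun [set: borelR R n] ((fun x => x + a) : borelR R n -> borelR R n).
Proof.
apply: measurable_rV => i; under eq_fun do rewrite mxE.
by apply: measurable_funD => //; exact: measurable_coord.
Qed.

Lemma measurable_consrV n : measurable_fun [set: measurableTypeR R * borelR R n]
  (consrV : _ -> borelR R n.+1).
Proof.
apply: measurable_rV => i; rewrite /consrV.
case: (splitP (i : 'I_(1 + n))) => j ij.
  have -> : i = lshift n j by exact: val_inj.
  under eq_fun do rewrite (row_mxEl (_%:M : 'rV_1)) mxE ord1 eqxx.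
  exact: measurable_fst.
have -> : i = rshift 1 j by exact: val_inj.
under eq_fun do rewrite (row_mxEr (_%:M : 'rV_1)).
exact: (measurableT_comp (@measurable_coord R n j) measurable_snd).
Qed.

Lemma lebesgue_rV_shift n (a : 'rV[R]_n) (A : set (borelR R n)) :
  measurable A -> lebesgue_rV R n ((fun x => x + a) @^-1` A) = lebesgue_rV R n A.
Proof.
elim: n a A => [|n IH] a A mA.
  by congr (lebesgue_rV R 0 _); apply/funext => x; rewrite /preimage/= (thinmx0 a) addr0.
rewrite /= /lebesgue_step.
pose a0 : R := a 0 ord0; pose a1 : 'rV[R]_n := \row_j a 0 (lift ord0 j).
pose f : measurableTypeR R * borelR R n -> measurableTypeR R * borelR R n :=
  fun p => (p.1 + a0, (p.2 : 'rV_n) + a1).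
have mf : measurable_fun setT f.
  apply: measurable_fun_pair; first exact: measurable_funD.
  exact: (measurableT_comp (measurable_shiftrV a1) measurable_snd).
have mcA : measurable (@consrV R n @^-1` A : set (measurableTypeR R * borelR R n)).
  by rewrite -[X in measurable X]setTI; exact: measurable_consrV.
have -> : @consrV R n @^-1` ((fun x => x + a) @^-1` A) = f @^-1` (@consrV R n @^-1` A).
  apply/funext => -[x v]; rewrite /preimage /f /=; congr (A _).
  rewrite /consrV/=.
  have -> : a = row_mx a0%:M a1 :> 'rV_(1 + n).
    apply/rowP => j; case: (splitP (j : 'I_(1 + n))) => k jk.
      have -> : j = lshift n k by exact: val_inj.
      by rewrite row_mxEl mxE (ord1 k) eqxx mulr1n; congr (a _ _); exact: val_inj.
    have -> : j = rshift 1 k by exact: val_inj.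
    by rewrite row_mxEr mxE; congr (a _ _); exact: val_inj.
  by rewrite (add_row_mx (x%:M : 'rV_1)) raddfD.
apply/esym; have := @product_measure_unique _ _ _ _ _ (@lebesgue_measure R) (lebesgue_rV R n)
  (measure_function_pushforward__canonical__measure_function_Measure
    (lebesgue_measure \x lebesgue_rV R n)%E mf).
apply => // B C mB mC; rewrite /= /pushforward.
rewrite (_ : f @^-1` _ = ((fun x => x + a0) @^-1` B) `*` ((fun x => x + a1) @^-1` C))//.
rewrite product_measure1E//.
- by rewrite -(lebesgue_measure_shift a0 mB); congr (_ * _)%E; exact: IH.
- rewrite -[X in measurable X]setTI.
  suff : measurable_fun [set: measurableTypeR R]
    ((fun x => x + a0) : measurableTypeR R -> measurableTypeR R) by exact.
  exact: measurable_funD.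
- by rewrite -[X in measurable X]setTI; exact: measurable_shiftrV.
Qed.

Lemma ge0_integral_invariant d (T : measurableType d)
    (m : {measure set T -> \bar R}) (f : T -> T) (D : set T) (g : T -> \bar R) :
  measurable_fun [set: T] f ->
  (forall A, measurable A -> m (f @^-1` A) = m A) ->
  measurable D -> measurable_fun D g -> (forall x, D x -> 0 <= g x)%E ->
  (\int[m]_(x in f @^-1` D) g (f x) = \int[m]_(x in D) g x)%E.
Proof.
move=> mf mfE mD mg g0.
transitivity (\int[m]_(x in f @^-1` D) (g \o f) x)%E; first by [].
rewrite -(ge0_integral_pushforward mf)//; last by move=> x /set_mem; exact: g0.
by apply: eq_measure_integral => A mA _; rewrite -mfE.
Qed.

Lemma integral_invariant d (T : measurableType d)
    (m : {measure set T -> \bar R}) (f : T -> T) (D : set T) (g : T -> \bar R) :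
  measurable_fun [set: T] f ->
  (forall A, measurable A -> m (f @^-1` A) = m A) ->
  measurable D -> measurable_fun D g ->
  (\int[m]_(x in f @^-1` D) g (f x) = \int[m]_(x in D) g x)%E.
Proof.
move=> mf mfE mD mg; rewrite [LHS]integralE [RHS]integralE.
rewrite -(ge0_integral_invariant mf mfE mD (measurable_funepos mg)
    (fun x _ => funepos_ge0 g x))
  -(ge0_integral_invariant mf mfE mD (measurable_funeneg mg)
    (fun x _ => funeneg_ge0 g x)).
have -> : (fun x => g (f x)) = g \o f by [].
by rewrite funepos_comp funeneg_comp.
Qed.

(** Both sides compute the double integral of 1_A(x) 1_B(x + O y): integrating
    in y first, a translation absorbs x; integrating in x first, a translation
    turns the integrand into 1_A(x - O y) 1_B(x), and then one in y absorbs x.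
    So the image of Lebesgue measure under O, being translation invariant, is
    a multiple of Lebesgue measure, and the factor is read off on any
    convenient set A. *)
Lemma lebesgue_rV_comparison n (O : 'rV[R]_n -> 'rV[R]_n)
    (A B : set (borelR R n)) :
  {morph O : x y / x + y} -> (forall x, exists y, O y = x) ->
  measurable_fun [set: borelR R n] (O : borelR R n -> borelR R n) ->
  measurable A -> measurable B ->
  (lebesgue_rV R n A * lebesgue_rV R n (O @^-1` B) =
   lebesgue_rV R n B * lebesgue_rV R n [set y | A (- O y)%R])%E.
Proof.
move=> OD Osurj mO mA mB; set l := lebesgue_rV R n.
have O0 : O 0 = 0 by apply: (addrI (O 0)); rewrite -OD !addr0.
have ON x : O (- x) = - O x by apply/eqP; rewrite -addr_eq0 -OD addNr O0.
have moppr : measurable_fun [set: borelR R n] ((fun x => - x) : borelR R n -> borelR R n).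
  apply: measurable_rV => i; under eq_fun do rewrite mxE.
  by apply: measurableT_comp => //; exact: measurable_coord.
have mpre (f : borelR R n -> borelR R n) C : measurable_fun setT f -> measurable C ->
    measurable (f @^-1` C).
  by move=> mf mC; rewrite -[X in measurable X]setTI; exact: mf.
have mOB : measurable ((O : borelR R n -> borelR R n) @^-1` B) by exact: mpre.
have mAO : measurable ([set y | A (- O y)] : set (borelR R n)).
  by apply: (mpre _ _ _ mA); apply: (measurableT_comp moppr mO).
have mI (C : set (borelR R n)) : measurable C ->
    measurable_fun [set: borelR R n] (fun x => (\1_C x)%:E : \bar R).
  by move=> mC; apply/measurable_EFinP.
have I0 (C : set (borelR R n)) x : (0%E <= (\1_C x)%:E :> \bar R)%E by rewrite lee_fin.
have intI (C : set (borelR R n)) : measurable C -> (\int[l]_x (\1_C x)%:E = l C)%E.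
  by move=> mC; rewrite integral_indic// setIT.
pose f1 (p : borelR R n * borelR R n) : \bar R :=
  ((\1_A p.1)%:E * (\1_B ((p.1 : 'rV[R]_n) + O p.2)%R)%:E)%E.
pose f2 (p : borelR R n * borelR R n) : \bar R :=
  ((\1_A ((p.1 : 'rV[R]_n) - O p.2)%R)%:E * (\1_B p.1)%:E)%E.
have mO2 : measurable_fun [set: borelR R n * borelR R n] (O \o snd : _ -> borelR R n).
  exact: (measurableT_comp mO measurable_snd).
have mf1 : measurable_fun setT f1.
  apply: emeasurable_funM; first exact: (measurableT_comp (mI _ mA) measurable_fst).
  apply: (measurableT_comp (mI _ mB)).
  by apply: measurable_funDV => //; exact: measurable_fst.
have mf2 : measurable_fun setT f2.
  apply: emeasurable_funM; last exact: (measurableT_comp (mI _ mB) measurable_fst).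
  apply: (measurableT_comp (mI _ mA)).
  apply: measurable_funDV; first exact: measurable_fst.
  exact: (measurableT_comp moppr mO2).
have shiftI (C : set (borelR R n)) a : measurable C ->
    (\int[l]_x (\1_C ((x : 'rV[R]_n) + a)%R)%:E = l C)%E.
  move=> mC; rewrite -(lebesgue_rV_shift a mC) -intI//.
  exact: (mpre _ _ (measurable_shiftrV a) mC).
transitivity (\int[l]_x \int[l]_y f1 (x, y))%E.
  rewrite -[in LHS](intI _ mA) -ge0_integralZr//; last exact: mI.
  apply: eq_integral => x _; rewrite /f1/=.
  rewrite ge0_integralZl//; last first.
    by apply: (measurableT_comp (mI _ mB)); exact: measurable_funDV.
  congr (_ * _)%E; have [w <-] := Osurj x.
  rewrite -(shiftI _ w mOB); apply: eq_integral => y _.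
  rewrite !indicE; congr ((nat_of_bool _)%:R%:E).
  by apply/idP/idP; rewrite !inE/= OD addrC.
rewrite (fubini_tonelli f1)//; last by move=> p; rewrite mule_ge0.
transitivity (\int[l]_y \int[l]_x f2 (x, y))%E.
  apply: eq_integral => y _.
  have mg : measurable_fun [set: borelR R n] (fun x => f2 (x, y)).
    exact: measurable_fun_pair1.
  rewrite -(ge0_integral_invariant (measurable_shiftrV (O y))
    (fun C mC => lebesgue_rV_shift (O y) mC) measurableT mg); last first.
    by move=> x _; rewrite mule_ge0.
  by apply: eq_integral => x _; rewrite /f1 /f2/= addrK.
rewrite -(fubini_tonelli f2)//; last by move=> p; rewrite mule_ge0.
rewrite -[in RHS](intI _ mB) -ge0_integralZr//; last exact: mI.
apply: eq_integral => x _; rewrite /f2/=.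
rewrite ge0_integralZr//; last first.
  by apply: (measurableT_comp (mI _ mA)); apply: measurable_funDV => //;
    exact: (measurableT_comp moppr mO).
rewrite muleC; congr (_ * _)%E.
have [w <-] := Osurj x.
rewrite -(shiftI _ (- w) mAO); apply: eq_integral => y _.
rewrite !indicE; congr ((nat_of_bool _)%:R%:E).
by apply/idP/idP; rewrite !inE/= OD ON opprD opprK addrC.
Qed.

End LebesgueInvariance.

(** * Euclidean geometry: inner product, norm, rotations *)

Section EuclideanGeometry.
Context {R : realType} {n : nat}.
Implicit Types (x y z : 'rV[R]_n) (a b : R).

Lemma dotrC x y : dotr x y = dotr y x.
Proof. by apply: eq_bigr => i _; rewrite mulrC. Qed.

Lemma dotrDl x y z : dotr (x + y) z = dotr x z + dotr y z.
Proof. by rewrite /dotr -big_split; apply: eq_bigr => i _; rewrite mxE mulrDl. Qed.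

Lemma dotrZl a x y : dotr (a *: x) y = a * dotr x y.
Proof. by rewrite /dotr mulr_sumr; apply: eq_bigr => i _; rewrite mxE mulrA. Qed.

Lemma dotrNl x y : dotr (- x) y = - dotr x y.
Proof. by rewrite -scaleN1r dotrZl mulN1r. Qed.

Lemma dotrDr x y z : dotr z (x + y) = dotr z x + dotr z y.
Proof. by rewrite dotrC dotrDl !(dotrC z). Qed.

Lemma dotrZr a x y : dotr x (a *: y) = a * dotr x y.
Proof. by rewrite dotrC dotrZl dotrC. Qed.

Lemma dotrNr x y : dotr x (- y) = - dotr x y.
Proof. by rewrite dotrC dotrNl dotrC. Qed.

Definition dotrE := (dotrDl, dotrDr, dotrNl, dotrNr, dotrZl, dotrZr).

Lemma dotr_ge0 x : 0 <= dotr x x.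
Proof. by apply: sumr_ge0 => i _; rewrite -expr2 sqr_ge0. Qed.

Lemma enorm_ge0 x : 0 <= enorm x.
Proof. exact: sqrtr_ge0. Qed.

Lemma sqr_enorm x : enorm x ^+ 2 = dotr x x.
Proof. by rewrite sqr_sqrtr// dotr_ge0. Qed.

Lemma coord_le_enorm x i : `|x 0 i| <= enorm x.
Proof.
rewrite -sqrtr_sqr ler_sqrt ?dotr_ge0// /dotr (bigD1 i)//= -expr2 lerDl.
by apply: sumr_ge0 => j _; rewrite -expr2 sqr_ge0.
Qed.

Lemma enorm0 : enorm (0 : 'rV[R]_n) = 0.
Proof. by rewrite /enorm /dotr big1 ?sqrtr0// => i _; rewrite mxE mul0r. Qed.

Lemma enorm_eq0 x : (enorm x == 0) = (x == 0).
Proof.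
apply/eqP/eqP => [x0|->]; last exact: enorm0.
apply/rowP => i; rewrite mxE; apply/eqP; rewrite -normr_le0 -x0.
exact: coord_le_enorm.
Qed.

Lemma enorm_gt0 x : (0 < enorm x) = (x != 0).
Proof. by rewrite lt0r enorm_eq0 enorm_ge0 andbT. Qed.

Lemma enormZ a x : enorm (a *: x) = `|a| * enorm x.
Proof.
by rewrite /enorm !dotrE mulrA -expr2 sqrtrM ?sqr_ge0// sqrtr_sqr.
Qed.

Lemma enormN x : enorm (- x) = enorm x.
Proof. by rewrite -scaleN1r enormZ normrN1 mul1r. Qed.

Lemma enormBC x y : enorm (x - y) = enorm (y - x).
Proof. by rewrite -enormN opprB. Qed.

(** Cauchy-Schwarz, from expanding the square of |y| x - |x| y. *)
Lemma dotr_le x y : dotr x y <= enorm x * enorm y.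
Proof.
have [->|x0] := eqVneq x 0.
  by rewrite enorm0 mul0r /dotr big1// => i _; rewrite mxE mul0r.
have [->|y0] := eqVneq y 0.
  by rewrite enorm0 mulr0 /dotr big1// => i _; rewrite mxE mulr0.
rewrite -!enorm_gt0 in x0 y0.
have := dotr_ge0 (enorm y *: x - enorm x *: y).
rewrite !dotrE (dotrC y x) -!sqr_enorm => h.
rewrite -(ler_pM2l (mulr_gt0 x0 y0)) -(@ler_pM2l _ 2)// -subr_ge0.
by apply: le_trans h _; rewrite le_eqVlt; apply/orP; left; apply/eqP; ring.
Qed.

Lemma normr_dotr_le x y : `|dotr x y| <= enorm x * enorm y.
Proof. by rewrite ler_norml dotr_le andbT lerNl -dotrNl -(enormN x) dotr_le. Qed.

Lemma ler_enormD x y : enorm (x + y) <= enorm x + enorm y.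
Proof.
rewrite -(@ler_pXn2r _ 2)// ?nnegrE ?addr_ge0 ?enorm_ge0//.
rewrite sqr_enorm !dotrE (dotrC y x) sqrrD !sqr_enorm mulr2n.
have := dotr_le x y; lra.
Qed.

Lemma ler_enormB x y z : enorm (x - z) <= enorm (x - y) + enorm (y - z).
Proof. by have := ler_enormD (x - y) (y - z); rewrite subrKA. Qed.

Lemma ler_dist_enorm x y : `|enorm x - enorm y| <= enorm (x - y).
Proof.
have h (u v : 'rV[R]_n) : enorm u - enorm v <= enorm (u - v).
  by rewrite lerBlDr; have := ler_enormD (u - v) v; rewrite subrK.
by rewrite ler_norml h andbT lerNl opprB enormBC h.
Qed.

Lemma normr_le_enorm x : `|x| <= enorm x.
Proof.
rewrite [leLHS]/Num.Def.normr/= mx_normrE; apply: bigmax_le; first exact: enorm_ge0.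
by move=> -[i j] _; rewrite (ord1 i) coord_le_enorm.
Qed.

Lemma coord_le_normr x i : `|x 0 i| <= `|x|.
Proof.
rewrite [leRHS]/Num.Def.normr/= mx_normrE.
exact: (le_bigmax _ (fun ij : 'I_1 * 'I_n => `|x ij.1 ij.2|) (0, i)).
Qed.

Lemma enorm_le_normr x : enorm x <= n%:R * `|x|.
Proof.
rewrite -(@ler_pXn2r _ 2)// ?nnegrE ?enorm_ge0 ?mulr_ge0// sqr_enorm.
have : dotr x x <= \sum_(i < n) `|x| ^+ 2.
  apply: ler_sum => i _; rewrite -expr2 -real_normK ?num_real//.
  by rewrite ler_pXn2r ?nnegrE// coord_le_normr.
rewrite sumr_const card_ord => /le_trans; apply.
rewrite exprMn -[leLHS]mulr_natl ler_wpM2r ?sqr_ge0// -natrX ler_nat.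
by case: n => // m; exact: (@leq_pexp2l m.+1 1 2).
Qed.

Lemma nbhs_enormP x (P : set 'rV[R]_n) :
  nbhs x P <-> exists2 d : R, 0 < d & forall y, enorm (y - x) < d -> P y.
Proof.
split=> [/nbhs_ballP[d /= d0 dP]|[d d0 dP]].
  exists d => // y yd; apply: dP; rewrite -ball_normE/= distrC.
  exact: le_lt_trans (normr_le_enorm _) yd.
have d1 : 0 < d / n.+1%:R by rewrite divr_gt0.
apply/nbhs_ballP; exists (d / n.+1%:R) => //= y.
rewrite -ball_normE/= distrC => yd; apply: dP.
apply: le_lt_trans (enorm_le_normr _) _.
have [->|y0] := eqVneq `|y - x| 0; first by rewrite mulr0.
apply: (@lt_trans _ _ (n.+1%:R * `|y - x|)); first by rewrite ltr_pM2r ?ltr_nat// lt0r y0/=.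
by rewrite mulrC -ltr_pdivlMr.
Qed.

Lemma continuous_enormP (f : 'rV[R]_n -> R) x :
  {for x, continuous f} <-> forall e : R, 0 < e -> exists2 d : R, 0 < d &
    forall y, enorm (y - x) < d -> `|f y - f x| < e.
Proof.
rewrite /continuous_at; split=> [fx e e0|H].
  move/cvgrPdist_lt : fx => /(_ _ e0) /nbhs_enormP[d d0 dP]; exists d => // y yd.
  by rewrite distrC; exact: dP.
apply/(@cvgrPdist_lt _ _ _ _ (nbhs_filter x) f) => e e0; apply/nbhs_enormP.
have [d d0 dP] := H _ e0.
by exists d => // y yd; rewrite distrC dP.
Qed.

Lemma continuous_enorm : continuous (@enorm R n).
Proof.
move=> x; apply/continuous_enormP => e e0; exists e => // y.
exact/le_lt_trans/ler_dist_enorm.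
Qed.

Lemma continuous_dotr y : continuous (dotr y).
Proof.
move=> x; apply/continuous_enormP => e e0.
have d0 : 0 < enorm y + 1 by rewrite ltr_wpDl ?enorm_ge0.
exists (e / (enorm y + 1)); first by rewrite divr_gt0.
move=> z; rewrite ltr_pdivlMr// mulrC; apply: le_lt_trans.
rewrite -dotrNr -dotrDr; apply: le_trans (normr_dotr_le _ _) _.
by rewrite ler_wpM2r ?enorm_ge0// lerDl.
Qed.

Lemma compact_ecball x r : compact (ecball x r).
Proof.
apply: bounded_closed_compact.
  exists (enorm x + r); split; first exact: num_real.
  move=> M rM y /= yxr; apply: le_trans (ltW rM); apply: le_trans (normr_le_enorm _) _.
  have := ler_enormD x (y - x); rewrite addrC subrK => /le_trans; apply.
  by rewrite lerD2l.
rewrite (_ : ecball x r = (fun y => enorm (y - x)) @^-1` [set t | t <= r])//.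
apply: closed_comp; last exact: closed_le.
move=> y _; apply/continuous_enormP => e e0; exists e => // z zy.
apply: le_lt_trans (ler_dist_enorm _ _) _.
by rewrite opprB addrA subrK.
Qed.

(** For unit vectors y and y', the rotation of the plane they span that takes
    y to y', as the composite of two reflections. Unlike the reflection that
    exchanges y and y', it tends to the identity when y' tends to y, so that
    moving cones can be brought to a fixed one without losing pointwise
    convergence of the integrands. *)
Definition rotation y y' z : 'rV[R]_n :=
  z - ((dotr y z + dotr y' z) / (1 + dotr y y')) *: (y + y') + (2 * dotr y z) *: y'.

Lemma rotationD y y' : {morph rotation y y' : z z' / z + z'}.
Proof. by move=> z z'; apply/rowP => i; rewrite !mxE !dotrE; ring. Qed.

Section Rotation.
Variables y y' : 'rV[R]_n.
Hypotheses (y1 : enorm y = 1) (y'1 : enorm y' = 1) (yy' : 1 + dotr y y' != 0).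

Let dy : dotr y y = 1. Proof. by rewrite -sqr_enorm y1 expr1n. Qed.
Let dy' : dotr y' y' = 1. Proof. by rewrite -sqr_enorm y'1 expr1n. Qed.

Lemma dotr_rotation z : dotr y' (rotation y y' z) = dotr y z.
Proof. by rewrite /rotation !dotrE dy' (dotrC y' y); field. Qed.

Lemma dotr_rotation_src z :
  dotr y (rotation y y' z) = 2 * dotr y y' * dotr y z - dotr y' z.
Proof. by rewrite /rotation !dotrE dy; field. Qed.

Lemma enorm_rotation z : enorm (rotation y y' z) = enorm z.
Proof.
rewrite /enorm; congr Num.sqrt; rewrite /rotation !dotrE dy dy' !(dotrC z) (dotrC y' y).
by field.
Qed.

Lemma rotationK z : rotation y' y (rotation y y' z) = z.
Proof.
rewrite {1}/rotation dotr_rotation dotr_rotation_src (dotrC y' y) /rotation.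
by apply/rowP => i; rewrite !mxE; field.
Qed.

End Rotation.

(** Quantifies that the rotation tends to the identity when y' tends to y. *)
Lemma enorm_rotation_sub y y' z : enorm y = 1 -> enorm y' = 1 -> 0 <= dotr y y' ->
  enorm (rotation y y' z - z) <= 6 * (enorm z * enorm (y' - y)).
Proof.
move=> y1 y'1 c0; set c := dotr y y' in c0 *.
set a := dotr y z; set b := dotr y' z; set k := (a + b) / (1 + c).
have c1 : 0 < 1 + c by rewrite ltr_pwDl.
have dy : dotr y y = 1 by rewrite -sqr_enorm y1 expr1n.
have -> : rotation y y' z - z = k *: (y' - y) + (2 * (a - k)) *: y'.
  by rewrite /rotation -/a -/b -/c -/k; apply/rowP => i; rewrite !mxE; ring.
have az : `|a| <= enorm z by rewrite (le_trans (normr_dotr_le _ _))// y1 mul1r.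
have bz : `|b| <= enorm z by rewrite (le_trans (normr_dotr_le _ _))// y'1 mul1r.
have k2 : `|k| <= 2 * enorm z.
  rewrite normrM normfV (gtr0_norm c1) ler_pdivrMr//.
  apply: le_trans (ler_normD _ _) _.
  have : enorm z <= enorm z * (1 + c) by rewrite ler_peMr ?enorm_ge0// lerDl.
  lra.
have akE : a - k = (a * dotr y (y' - y) - dotr (y' - y) z) / (1 + c).
  rewrite !dotrE dy -/c -/a -/b /k; field; exact: lt0r_neq0.
have ak : `|a - k| <= 2 * (enorm z * enorm (y' - y)).
  rewrite akE normrM normfV (gtr0_norm c1) ler_pdivrMr//.
  have h1 : `|a * dotr y (y' - y)| <= enorm z * enorm (y' - y).
    rewrite normrM ler_pM// (le_trans (normr_dotr_le _ _))// y1 mul1r//.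
  have h2 : `|dotr (y' - y) z| <= enorm z * enorm (y' - y).
    by rewrite mulrC normr_dotr_le.
  apply: le_trans (ler_normB _ _) _.
  have h3 : 0 <= enorm z * enorm (y' - y) by rewrite mulr_ge0 ?enorm_ge0.
  have : enorm z * enorm (y' - y) <= enorm z * enorm (y' - y) * (1 + c).
    by rewrite ler_peMr// lerDl.
  lra.
apply: le_trans (ler_enormD _ _) _.
rewrite !enormZ y'1 mulr1 [`|2 * _|]normrM (ger0_norm (ler0n _ 2)).
have : `|k| * enorm (y' - y) <= 2 * enorm z * enorm (y' - y).
  by rewrite ler_wpM2r ?enorm_ge0.
lra.
Qed.

End EuclideanGeometry.

(** * Isometry invariance and homogeneity of Lebesgue measure *)

Section LebesgueGeometry.
Context {R : realType}.

Lemma continuous_measurable_rV n (f : 'rV[R]_n -> R) :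
  continuous f -> measurable_fun [set: borelR R n] (f : borelR R n -> R).
Proof.
move=> cf; apply: (measurability (@RGenOInfty.G R)).
  exact: RGenOInfty.measurableE.
move=> _ [_ [x ->] <-]; rewrite setTI; apply: sub_sigma_algebra.
by have /continuousP := cf; apply; rewrite set_itvE; exact: open_gt.
Qed.

Lemma measurable_dotr n (y : 'rV[R]_n) :
  measurable_fun [set: borelR R n] (dotr y : borelR R n -> R).
Proof. by apply: continuous_measurable_rV; exact: continuous_dotr. Qed.

Lemma measurable_preimage_borel d (T : measurableType d) n (f : T -> 'rV[R]_n)
    (A : set (borelR R n)) :
  measurable_fun [set: T] (f : T -> borelR R n) -> measurable A ->
  measurable (f @^-1` A).
Proof. by move=> mf mA; rewrite -[X in measurable X]setTI; exact: mf. Qed.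

Lemma measurable_scalerV n (t : R) :
  measurable_fun [set: borelR R n] ((fun z => t *: z) : borelR R n -> borelR R n).
Proof.
apply: measurable_rV => i; under eq_fun do rewrite mxE.
by apply: measurable_funM => //; exact: measurable_coord.
Qed.

Definition cube n (x : 'rV[R]_n) (e : R) : set 'rV[R]_n :=
  [set v | forall i, `|v 0 i - x 0 i| < e].

Lemma lebesgue_rV_cube n (x : 'rV[R]_n) e : 0 < e ->
  measurable (cube x e : set (borelR R n)) /\
  lebesgue_rV R n (cube x e) = ((2 * e) ^+ n)%:E.
Proof.
move=> e0.
have cubeE : cube x e = [set v : 'rV[R]_n | forall i,
    [set` `]x 0 i - e, x 0 i + e[] (v 0 i)].
  by apply/seteqP; split => v /= H i; move: (H i); rewrite /= in_itv/= ltr_distl.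
have mB i : measurable ([set` `]x 0 i - e, x 0 i + e[] : set (measurableTypeR R)).
  exact: measurable_itv.
split.
  rewrite cubeE (_ : mkset _ = \bigcap_(i : 'I_n) ([set: borelR R n] `&`
      (fun v : 'rV[R]_n => v 0 i) @^-1` [set` `]x 0 i - e, x 0 i + e[])).
    by apply: fin_bigcap_measurable => // i _; exact: measurable_coord.
  by apply/seteqP; split => [v Av i _|v Av i]; [split => //; exact: Av|
     have [] := Av i I].
rewrite cubeE (@lebesgue_rV_box R n (fun i => [set` `]x 0 i - e, x 0 i + e[]))//.
transitivity (\big[mule/1%E]_(i < n) (2 * e)%:E)%E.
  apply: eq_bigr => i _; rewrite lebesgue_measure_itv/= lte_fin ltrD2l gtrN//.
  by rewrite -EFinD; congr EFin; ring.
rewrite big_const card_ord; elim: n {x cubeE mB} => [|n IH]; first by rewrite expr0.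
by rewrite iterS IH -EFinM exprS.
Qed.

Lemma cube_nbhs n (x : 'rV[R]_n) U : nbhs x U -> exists2 e, 0 < e & cube x e `<=` U.
Proof.
move=> /nbhs_ballP[e e0 eU]; exists e => // v xv; apply: eU; split => // i j.
by rewrite (ord1 i) /ball/= distrC; exact: xv.
Qed.

Lemma open_measurable_rV n (U : set 'rV[R]_n) :
  open U -> measurable (U : set (borelR R n)).
Proof. exact: sub_sigma_algebra. Qed.

Lemma lebesgue_rV_open_gt0 n (U : set 'rV[R]_n) x : open U -> U x ->
  (0 < lebesgue_rV R n U)%E.
Proof.
move=> oU Ux; have /cube_nbhs[e e0 eU] : nbhs x U by exact: open_nbhs_nbhs.
have [mC CE] := lebesgue_rV_cube x e0.
apply: (@lt_le_trans _ _ (lebesgue_rV R n (cube x e))).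
  by rewrite CE lte_fin exprn_gt0// mulr_gt0.
by apply: le_measure => //; rewrite inE//; exact: open_measurable_rV.
Qed.

Lemma lebesgue_rV_bounded n (A : set (borelR R n)) r : measurable A ->
  (forall z, A z -> enorm (z : 'rV[R]_n) <= r) -> (lebesgue_rV R n A < +oo)%E.
Proof.
move=> mA Ar; pose e := Num.max r 0 + 1.
have e0 : 0 < e by rewrite ltr_wpDl// le_max lexx orbT.
have [mC CE] := lebesgue_rV_cube (0 : 'rV[R]_n) e0.
apply: (@le_lt_trans _ _ (lebesgue_rV R n (cube 0 e))); last by rewrite CE ltry.
apply: le_measure; rewrite ?inE// => z /Ar zr i; rewrite mxE subr0.
apply: le_lt_trans (coord_le_enorm _ _) _; apply: le_lt_trans zr _.
by rewrite /e ltr_pwDr// le_max lexx.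
Qed.

Lemma measurable_enorm_set n (P : set R) :
  measurable (P : set (measurableTypeR R)) ->
  measurable ([set z | P (enorm z)] : set (borelR R n)).
Proof. by move=> mP; rewrite -[X in measurable X]setTI; exact: measurable_enorm. Qed.

Lemma measurable_enorm_ge n (t : R) :
  measurable ([set z | t <= enorm (z : 'rV[R]_n)] : set (borelR R n)).
Proof.
rewrite (_ : mkset _ = [set z | `[t, +oo[%classic (enorm z)]).
  by apply: measurable_enorm_set; exact: measurable_itv.
by apply/seteqP; split => z /=; rewrite in_itv/= andbT.
Qed.

Section Isometry.
Variables (n : nat) (O : 'rV[R]_n -> 'rV[R]_n).
Hypothesis OD : {morph O : x y / x + y}.
Hypothesis Oe : forall z, enorm (O z) = enorm z.

Lemma measurable_isometry :
  measurable_fun [set: borelR R n] (O : borelR R n -> borelR R n).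
Proof.
have O0 : O 0 = 0 by apply: (addrI (O 0)); rewrite -OD !addr0.
have ON x : O (- x) = - O x by apply/eqP; rewrite -addr_eq0 -OD addNr O0.
apply: measurable_rV => i; apply: continuous_measurable_rV => x.
apply/(continuous_enormP (fun t => O t 0 i)) => e e0; exists e => // y; apply: le_lt_trans.
rewrite -Oe OD ON; apply: le_trans (coord_le_enorm _ i).
by rewrite !mxE.
Qed.

Hypothesis Osurj : forall x, exists y, O y = x.

(** The comparison factor is 1, as seen on the unit ball: it is invariant under
    O and of positive finite measure. *)
Lemma lebesgue_rV_isometry (B : set (borelR R n)) : measurable B ->
  lebesgue_rV R n (O @^-1` B) = lebesgue_rV R n B.
Proof.
move=> mB; pose A : set (borelR R n) := [set z | enorm (z : 'rV[R]_n) < 1].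
have oA : open (A : set 'rV[R]_n).
  rewrite /A (_ : mkset _ = @enorm R n @^-1` [set t | t < 1])//.
  by apply: open_comp; [move=> x _; exact: continuous_enorm|exact: open_lt].
have mA : measurable A by exact: open_measurable_rV.
have := lebesgue_rV_comparison OD Osurj measurable_isometry mA mB.
rewrite (_ : [set y | A (- O y)] = A); last first.
  by apply/seteqP; split => z; rewrite /A/= enormN Oe.
rewrite [in X in _ = X -> _]muleC.
have A0 : (0 < lebesgue_rV R n A)%E.
  by apply: (@lebesgue_rV_open_gt0 n A 0 oA); rewrite /A/= enorm0.
have Aoo : (lebesgue_rV R n A < +oo)%E.
  by apply: (@lebesgue_rV_bounded n A 1) => // z /ltW.
have Afin : lebesgue_rV R n A \is a fin_num by rewrite ge0_fin_numE// ltW.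
move=> h; have := congr1 (fun x => (((fine (lebesgue_rV R n A))^-1)%:E * x)%E) h.
rewrite !muleA -{2 4}(fineK Afin) -!EFinM mulVf ?mul1e//.
by rewrite gt_eqF// fine_gt0// A0.
Qed.

End Isometry.

(** Here the comparison factor is read off on a cube. *)
Lemma lebesgue_rV_scale n (t : R) (B : set (borelR R n)) : 0 < t -> measurable B ->
  lebesgue_rV R n ((fun z => t *: z) @^-1` B) = ((t^-1 ^+ n)%:E * lebesgue_rV R n B)%E.
Proof.
move=> t0 mB; have t0' : t != 0 by rewrite gt_eqF.
have OD : {morph (fun z : 'rV[R]_n => t *: z) : x y / x + y}.
  by move=> x y; rewrite scalerDr.
have Os (x : 'rV[R]_n) : exists y, t *: y = x.
  by exists (t^-1 *: x); rewrite scalerA divff// scale1r.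
have [mA AE] := lebesgue_rV_cube (0 : 'rV[R]_n) (@ltr01 R).
have ti0 : 0 < t^-1 by rewrite invr_gt0.
have [mA' AE'] := lebesgue_rV_cube (0 : 'rV[R]_n) ti0.
have := lebesgue_rV_comparison OD Os (measurable_scalerV t) mA mB.
rewrite (_ : [set y | cube 0 1 (- (t *: y))] = cube (0 : 'rV[R]_n) t^-1); last first.
  apply/seteqP; split => z H i; move: (H i); rewrite !mxE !subr0 normrN normrM (gtr0_norm t0).
    by rewrite -ltr_pdivlMl// mulr1.
  by rewrite -ltr_pdivlMl// mulr1.
rewrite AE AE' mulr1 exprMn => h.
have := congr1 (fun x => (((2 ^+ n)^-1)%:E * x)%E) h.
have n2 : (2 ^+ n : R) != 0 by rewrite expf_neq0.
rewrite muleA -EFinM mulVf// mul1e => ->.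
by rewrite muleCA -EFinM mulrA mulVf// mul1r muleC.
Qed.

Lemma bernoulli_ineq (d : R) n : 0 <= d <= 1 -> 1 - n%:R * d <= (1 - d) ^+ n.
Proof.
move=> /andP[d0 d1]; elim: n => [|n IH]; first by rewrite mul0r subr0 expr0.
rewrite exprSr; have : (1 - n%:R * d) * (1 - d) <= (1 - d) ^+ n * (1 - d).
  by rewrite ler_wpM2r// subr_ge0.
apply: le_trans; rewrite -natr1.
have : 0 <= n%:R * d * d by rewrite !mulr_ge0.
lra.
Qed.

(** The closed ball of radius r(1 - d) has almost the measure of the closed ball
    of radius r, by homogeneity, and it misses the sphere. *)
Lemma lebesgue_rV_sphere n (r : R) : (0 < n)%N -> 0 < r ->
  lebesgue_rV R n [set z : 'rV[R]_n | enorm z = r] = 0%E.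
Proof.
case: n => // n _ r0; set S := mkset _; set l := lebesgue_rV R n.+1.
pose A : set (borelR R n.+1) := [set z | enorm (z : 'rV[R]_n.+1) <= r].
have mS : measurable (S : set (borelR R n.+1)).
  exact: (measurable_enorm_set (measurable_set1 r)).
have mA : measurable A.
  rewrite /A (_ : mkset _ = [set z | `]-oo, r]%classic (enorm z)]).
    by apply: measurable_enorm_set; exact: measurable_itv.
  by apply/seteqP; split => z /=; rewrite in_itv.
have Aoo : (l A < +oo)%E by exact: (@lebesgue_rV_bounded _ A r).
have Afin : l A \is a fin_num by rewrite ge0_fin_numE.
have Sfin : l S \is a fin_num.
  rewrite ge0_fin_numE//; apply: (@lebesgue_rV_bounded _ S r) => // z.
  by rewrite /S/= => ->.
set a := fine (l A); set b := fine (l S).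
have a0 : 0 <= a by rewrite fine_ge0.
have b0 : 0 <= b by rewrite fine_ge0.
have key (d : R) : 0 < d < 1 -> b <= n.+1%:R * d * a.
  move=> /andP[d0 d1]; pose t := (1 - d)^-1.
  have t0 : 0 < t by rewrite invr_gt0 subr_gt0.
  have := lebesgue_rV_scale t0 mA; rewrite /t invrK -/l -/t.
  set A' := (X in l X = _) => A'E.
  have mA' : measurable (A' : set (borelR R n.+1)).
    by rewrite -[X in measurable X]setTI; exact: measurable_scalerV.
  have dis : [disjoint S & A'].
    apply/disj_setPS => z []; rewrite /S/= => zr; rewrite /A' /A/= enormZ zr gtr0_norm//.
    by rewrite -ler_pdivlMr// divff ?gt_eqF// leNgt /t invf_gt1 ?subr_gt0// gtrBl d0.
  have : (l (S `|` A') <= l A)%E.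
    apply: le_measure; rewrite ?inE//; first exact: measurableU.
    move=> z [|]; first by rewrite /S /A/= => ->.
    rewrite /A' /A/= enormZ gtr0_norm//; apply: le_trans.
    by rewrite ler_peMl ?enorm_ge0// ltW// /t invf_gt1 ?subr_gt0// gtrBl.
  have -> : l (S `|` A') = (l S + l A')%E by apply: measureU => //; exact/disj_set2P.
  rewrite A'E -(fineK Afin) -(fineK Sfin) -/a -/b -EFinM -EFinD lee_fin.
  have := @bernoulli_ineq d n.+1; rewrite (ltW d0) (ltW d1) => /(_ erefl) h.
  have : (1 - n.+1%:R * d) * a <= (1 - d) ^+ n.+1 * a by rewrite ler_wpM2r.
  lra.
suff b00 : b = 0 by rewrite -(fineK Sfin) -/b b00.
apply/eqP; rewrite eq_le b0 andbT leNgt; apply/negP => b_gt0.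
pose c := n.+1%:R * a; have c0 : 0 <= c by rewrite mulr_ge0.
have cb : 0 < 2 * (c + b) by rewrite mulr_gt0// ltr_wpDl.
have := key (b / (2 * (c + b))).
rewrite divr_gt0//= ltr_pdivrMr// mul1r mulrAC -/c mulrA ler_pdivlMr//.
have bc : 0 <= b * c by rewrite mulr_ge0.
have bb : 0 < b * b by rewrite mulr_gt0.
suff -> : b < 2 * (c + b) by move=> /(_ erefl); nra.
lra.
Qed.

End LebesgueGeometry.

(** * The Levy condition *)

Section LevyDensity.
Context {R : realType} {N : nat} (s : R).
Hypothesis s12 : 2^-1 < s < 1.
Hypothesis C0 : 0 < @CNs R N s.

Notation lam := (lebesgue_rV R N).
Notation dens := (@mu_density R N s).
Notation scl t := ((fun z : 'rV[R]_N => t *: z) : borelR R N -> borelR R N).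

Let s_gt0 : 0 < s. Proof. by have /andP[+ _] := s12; apply: lt_trans; rewrite invr_gt0. Qed.
Let p_gt0 : 0 < N%:R + 2 * s. Proof. by rewrite ltr_wpDl// mulr_gt0. Qed.

Lemma density_ge0 z : 0 <= dens z.
Proof. by rewrite divr_ge0 ?(ltW C0)// powR_ge0. Qed.

Lemma density_gt0 (z : 'rV[R]_N) : z != 0 -> 0 < dens z.
Proof. by move=> z0; rewrite divr_gt0// powR_gt0// enorm_gt0. Qed.

Lemma measurable_density : measurable_fun [set: borelR R N] (dens : borelR R N -> R).
Proof.
rewrite /mu_density (_ : (fun z => _) =
    (fun z : borelR R N => @CNs R N s * (enorm z `^ (N%:R + 2 * s)) `^ (-1))).
  apply: measurable_funM => //.
  apply: (measurableT_comp (measurable_powR (-1))).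
  exact: (measurableT_comp (measurable_powR _) (@measurable_enorm R N)).
by apply/funext => z; rewrite powR_inv1// powR_ge0.
Qed.

Lemma density_scale (t : R) (z : 'rV[R]_N) : 0 < t ->
  dens z = t `^ (N%:R + 2 * s) * dens (t *: z).
Proof.
move=> t0; rewrite /mu_density enormZ (gtr0_norm t0) powRM ?enorm_ge0 ?(ltW t0)//.
by rewrite invfM [in RHS]mulrCA mulVKf// gt_eqF// powR_gt0.
Qed.

Lemma ge0_integral_selfsimilar (g : borelR R N -> R) (D : set (borelR R N)) (t c : R) :
  0 < t -> 0 <= c -> measurable D -> measurable_fun [set: borelR R N] g ->
  (forall z, 0 <= g z) -> (forall z : 'rV[R]_N, g z = c * g (t *: z)) ->
  (\int[lam]_(z in scl t @^-1` D) (g z)%:E =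
   (c * t^-1 ^+ N)%:E * \int[lam]_(z in D) (g z)%:E)%E.
Proof.
move=> t0 c0 mD mg g0 gt.
have mS := @measurable_scalerV R N t.
have mpre : measurable (scl t @^-1` D).
  by rewrite -[X in measurable X]setTI; exact: mS.
have mgE E : measurable_fun E (fun z => (g z)%:E : \bar R).
  by apply/measurable_EFinP; exact: measurable_funTS.
transitivity (c%:E * \int[lam]_(z in scl t @^-1` D)
    ((fun z => (g z)%:E) \o scl t) z)%E.
  rewrite -ge0_integralZl_EFin//.
  - by apply: eq_integral => z _; rewrite -EFinM -gt.
  - by move=> z _; rewrite lee_fin; exact: g0.
  - by apply: measurable_funTS; exact: (measurableT_comp (mgE setT) mS).
rewrite -(@ge0_integral_pushforward _ _ _ _ _ _ mS lam D (fun z => (g z)%:E))//;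
  last by move=> z _; rewrite lee_fin.
have k0 : 0 <= t^-1 ^+ N by rewrite exprn_ge0// invr_ge0 ltW.
rewrite (eq_measure_integral (mscale (NngNum k0) lam)); last first.
  by move=> A mA _; exact: lebesgue_rV_scale.
rewrite ge0_integral_mscale//; last by move=> z _; rewrite lee_fin.
by rewrite muleA EFinM.
Qed.

(** If a set grows by adding a piece B and a rescaled copy of itself, the
    integral X over it satisfies X_(k+1) = x_B + q X_k; it stays bounded
    for q < 1 and grows at least linearly for q >= 1. *)
Section SelfSimilar.
Variables (g : borelR R N -> R) (A : nat -> set (borelR R N)) (B : set (borelR R N)).
Variables (t c : R).
Hypotheses (t0 : 0 < t) (c0 : 0 <= c).
Hypotheses (mg : measurable_fun [set: borelR R N] g) (g0 : forall z, 0 <= g z).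
Hypothesis (gt : forall z : 'rV[R]_N, g z = c * g (t *: z)).
Hypotheses (mA : forall k, measurable (A k)) (mB : measurable B).
Hypothesis (A0 : A 0%N = set0).
Hypothesis AS : forall k, A k.+1 = B `|` scl t @^-1` A k.
Hypothesis AB : forall k, [disjoint B & scl t @^-1` A k].

Let q := c * t^-1 ^+ N.

Let q0 : 0 <= q. Proof. by rewrite mulr_ge0// exprn_ge0// invr_ge0 ltW. Qed.

Let mgE E : measurable_fun E (fun z => (g z)%:E : \bar R).
Proof. by apply/measurable_EFinP; exact: measurable_funTS. Qed.

Lemma selfsimilar_rec k : (\int[lam]_(z in A k.+1) (g z)%:E =
  \int[lam]_(z in B) (g z)%:E + q%:E * \int[lam]_(z in A k) (g z)%:E)%E.
Proof.
rewrite AS ge0_integral_setU//; last by move=> z _; rewrite lee_fin.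
  by rewrite (@ge0_integral_selfsimilar g (A k) t c).
by rewrite -[X in measurable X]setTI; exact: (@measurable_scalerV R N t).
Qed.

Lemma selfsimilar_ltry : q < 1 -> (\int[lam]_(z in B) (g z)%:E < +oo)%E ->
  nondecreasing_seq A -> (\int[lam]_(z in \bigcup_k A k) (g z)%:E < +oo)%E.
Proof.
move=> q1 Boo ndA.
have Bfin : (\int[lam]_(z in B) (g z)%:E)%E \is a fin_num.
  by rewrite ge0_fin_numE// integral_ge0// => z _; rewrite lee_fin.
set b := fine (\int[lam]_(z in B) (g z)%:E)%E.
have q1' : 0 < 1 - q by rewrite subr_gt0.
have bd k : (\int[lam]_(z in A k) (g z)%:E <= (b / (1 - q))%:E)%E.
  elim: k => [|k IH].
    rewrite A0 integral_set0 lee_fin divr_ge0 ?(ltW q1')// fine_ge0//.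
    by rewrite integral_ge0// => z _; rewrite lee_fin.
  rewrite selfsimilar_rec; apply: le_trans.
    by apply: leeD2l; apply: lee_wpmul2l; [rewrite lee_fin|exact: IH].
  rewrite -(fineK Bfin) -/b -EFinM -EFinD lee_fin le_eqVlt; apply/orP; left.
  by apply/eqP; field; rewrite gt_eqF.
have cv := @ge0_nondecreasing_set_cvg_integral _ _ _ A (fun z => (g z)%:E) lam ndA mA
  (fun i => @mgE (A i)) (fun i z _ => g0 z).
apply: (@le_lt_trans _ _ (b / (1 - q))%:E); last exact: ltry.
rewrite -(cvg_lim _ cv)//; apply: lime_le; last by near=> k; exact: bd.
by apply/cvg_ex; eexists; exact: cv.
Unshelve. all: by end_near.
Qed.

Lemma selfsimilar_ge k : 1 <= q ->
  (k%:R%:E * \int[lam]_(z in B) (g z)%:E <= \int[lam]_(z in A k) (g z)%:E)%E.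
Proof.
move=> q1.
have X0 E : (0 <= \int[lam]_(z in E) (g z)%:E)%E.
  by apply: integral_ge0 => z _; rewrite lee_fin.
elim: k => [|k IH]; first by rewrite mul0e.
rewrite selfsimilar_rec -natr1 addrC EFinD ge0_muleDl ?lee_fin// mul1e.
apply: leeD2l; apply: le_trans IH _; rewrite -[leLHS]mul1e.
by apply: lee_wpmul2r => //; rewrite lee_fin.
Qed.

End SelfSimilar.

(** Integrability of this weight is the Levy condition; it is what makes bounded
    functions with a quadratic zero at the origin integrable. *)
Definition levy_weight : borelR R N -> R :=
  fun z => Num.min (enorm (z : 'rV[R]_N) ^+ 2) 1 * dens z.

Lemma levy_weight_ge0 z : 0 <= levy_weight z.
Proof. by rewrite mulr_ge0 ?density_ge0// le_min ler01 sqr_ge0. Qed.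

Lemma measurable_levy_weight :
  measurable_fun [set: borelR R N] (levy_weight : borelR R N -> R).
Proof.
apply: measurable_funM; last exact: measurable_density.
apply: measurable_minr => //.
by apply: measurable_funX; exact: measurable_enorm.
Qed.

Lemma two_powR_dimD : (2 : R) `^ (N%:R + 2 * s) = 2 ^+ N * 2 `^ (2 * s).
Proof. by rewrite powRD ?pnatr_eq0 ?implybT// powR_mulrn. Qed.

Let pow2s_lt4 : (2 : R) `^ (2 * s) < 4.
Proof.
have -> : 4 = (2 : R) `^ 2%:R by rewrite powR_mulrn// expr2; ring.
rewrite /powR pnatr_eq0/= ltr_expR ltr_pM2r ?ln_gt0 ?ltr1n//.
by have /andP[_] := s12; lra.
Qed.

Lemma two_powR_ge2 : 2 <= (2 : R) `^ (2 * s).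
Proof.
rewrite -{1}[2](@powRr1 R)//; apply: ler_powR; first by rewrite ler1n.
by have /andP[+ _] := s12; lra.
Qed.

Definition annulus (a b : R) : set (borelR R N) := [set z | a <= enorm (z : 'rV[R]_N) < b].

Lemma measurable_annulus a b : measurable (annulus a b).
Proof.
rewrite /annulus (_ : mkset _ = [set z | `[a, b[%classic (enorm z)]).
  by apply: measurable_enorm_set; exact: measurable_itv.
by apply/seteqP; split => z /=; rewrite in_itv.
Qed.

Lemma scale_annulus (t a b : R) : 0 < t ->
  scl t @^-1` annulus a b = annulus (a / t) (b / t).
Proof.
move=> t0; apply/seteqP; split => z; rewrite /annulus/= enormZ (gtr0_norm t0);
  by rewrite ler_pdivrMr// ltr_pdivlMr// ![_ * t]mulrC.
Qed.

Lemma annulusU (a b c : R) : a <= b -> b <= c ->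
  annulus a b `|` annulus b c = annulus a c.
Proof.
move=> ab bc; apply/seteqP; split => z; rewrite /annulus/=.
  by case=> /andP[h1 h2]; [rewrite h1 (lt_le_trans h2)|rewrite h2 (le_trans ab)].
by move=> /andP[-> ->]; case: (ltP (enorm z) b) => _; [left|right].
Qed.

Lemma annulus_disj (a b c d : R) : b <= c -> [disjoint annulus a b & annulus c d].
Proof.
move=> bc; apply/disj_setPS => z [] /= /andP[_ zb] /andP[cz _].
by move: (lt_le_trans zb (le_trans bc cz)); rewrite ltxx.
Qed.

Lemma density_le (a : R) (z : 'rV[R]_N) : 0 < a -> a <= enorm z ->
  dens z <= @CNs R N s / a `^ (N%:R + 2 * s).
Proof.
move=> a0 az; rewrite ler_wpM2l ?(ltW C0)// lef_pV2 ?posrE ?powR_gt0//.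
  by apply: ge0_ler_powR; rewrite ?nnegrE ?(ltW p_gt0) ?enorm_ge0// ltW.
exact: lt_le_trans az.
Qed.

Lemma integral_bounded_ltry (g : borelR R N -> R) (D : set (borelR R N)) (M r : R) :
  measurable D -> measurable_fun [set: borelR R N] g -> (forall z, 0 <= g z) ->
  (forall z, D z -> g z <= M) -> (forall z, D z -> enorm (z : 'rV[R]_N) <= r) ->
  (\int[lam]_(z in D) (g z)%:E < +oo)%E.
Proof.
move=> mD mg g0 gM Dr; pose M' := Num.max M 0.
apply: (@le_lt_trans _ _ (\int[lam]_(z in D) (cst M'%:E) z)%E).
  apply: ge0_le_integral => //.
  - by move=> z _; rewrite lee_fin.
  - by apply/measurable_EFinP; exact: measurable_funTS.
  - by move=> z Dz; rewrite lee_fin le_max gM.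
rewrite integral_cst// lte_mul_pinfty ?lee_fin ?le_max ?lexx ?orbT//.
exact: lebesgue_rV_bounded Dr.
Qed.

Let mulV2n : (2 : R)^-1 ^+ N * 2 ^+ N = 1.
Proof. by rewrite -exprMn mulVf ?expr1n. Qed.

(** Halving shells toward the origin multiplies this integral by 2^(2s-2) < 1. *)
Lemma integral_sqr_density_ltry :
  (\int[lam]_(z in annulus 0 1) (enorm (z : 'rV[R]_N) ^+ 2 * dens z)%:E < +oo)%E.
Proof.
set g := fun z : borelR R N => enorm (z : 'rV[R]_N) ^+ 2 * dens z.
have mg : measurable_fun [set: borelR R N] g.
  apply: measurable_funM; last exact: measurable_density.
  by apply: measurable_funX; exact: measurable_enorm.
have g0 z : 0 <= g z by rewrite mulr_ge0 ?sqr_ge0 ?density_ge0.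
pose A k := annulus ((2 : R)^-1 ^+ k) 1.
have h1 k : (2 : R)^-1 ^+ k <= 1 by rewrite exprn_ile1// ?invr_ge0// invf_le1// ler1n.
have h0 k : 0 < (2 : R)^-1 ^+ k by rewrite exprn_gt0// invr_gt0.
have pre k : scl 2 @^-1` A k = annulus ((2 : R)^-1 ^+ k.+1) 2^-1.
  by rewrite /A scale_annulus// mul1r exprSr.
have : (\int[lam]_(z in \bigcup_k A k) (g z)%:E < +oo)%E.
  apply: (@selfsimilar_ltry g A (annulus 2^-1 1) 2 (2 `^ (N%:R + 2 * s) / 2 ^+ 2)) => //.
  - move=> z; rewrite /g (@density_scale 2 z)// enormZ (ger0_norm (ler0n _ 2)).
    by field.
  - by move=> k; exact: measurable_annulus.
  - exact: measurable_annulus.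
  - apply/seteqP; split => z //; rewrite /A /annulus/= expr0.
    by move=> /andP[/le_lt_trans /[apply]]; rewrite ltxx.
  - by move=> k; rewrite pre setUC annulusU ?invf_le1 ?ler1n// exprS ler_piMr// invr_ge0.
  - by move=> k; rewrite pre disj_set_sym annulus_disj.
  - rewrite two_powR_dimD mulrAC [X in X / _]mulrAC (mulrC (2 ^+ N)) mulV2n mul1r.
    rewrite ltr_pdivrMr// mul1r.
    by apply: lt_le_trans pow2s_lt4 _; rewrite expr2; lra.
  - have h2 : 0 < (2 : R)^-1 by rewrite invr_gt0.
    apply: (@integral_bounded_ltry _ _ (1 * (@CNs R N s / 2^-1 `^ (N%:R + 2 * s))) 1) => //.
    + exact: measurable_annulus.
    + move=> z /andP[z2 z1]; apply: ler_pM; rewrite ?sqr_ge0 ?density_ge0//.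
        by rewrite exprn_ile1 ?enorm_ge0// ltW.
      exact: density_le.
    + by move=> z /andP[_ /ltW].
  - apply/nondecreasing_seqP => k; apply/subsetPset => z; rewrite /A /annulus/= => /andP[h ->].
    rewrite andbT; apply: le_trans h.
    by rewrite exprS ler_piMl ?exprn_ge0 ?invr_ge0// invf_le1// ler1n.
rewrite integral_mkcond [X in _ -> (X < _)%E]integral_mkcond.
rewrite (_ : ((fun z => (g z)%:E) \_ (\bigcup_k A k)) =
  ((fun z => (g z)%:E) \_ (annulus 0 1)))//.
apply/funext => z; rewrite !patchE.
have [->|z0] := eqVneq (z : 'rV[R]_N) 0.
  by rewrite /g enorm0 expr0n/= mul0r; case: ifP; case: ifP.
rewrite (_ : (z \in \bigcup_k A k) = (z \in annulus 0 1))//.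
apply/idP/idP; rewrite !inE.
  by case=> k _ /andP[h z1]; apply/andP; split; [exact: enorm_ge0|].
move=> /andP[_ z1].
have : (fun k => (2 : R)^-1 ^+ k) @ \oo --> (0 : R).
  by apply: cvg_expr; rewrite ger0_norm ?invr_ge0// invf_lt1// ltr1n.
move/cvgrPdist_lt => /(_ (enorm (z : 'rV[R]_N))).
rewrite enorm_gt0 => /(_ z0)[k _ /(_ k (leqnn k))].
rewrite sub0r normrN ger0_norm ?(ltW (h0 k))// => /ltW zk.
by exists k => //; apply/andP; split.
Qed.

(** Doubling shells toward infinity multiplies this integral by 2^(-2s) < 1. *)
Lemma integral_density_ltry :
  (\int[lam]_(z in [set z | (1 <= enorm (z : 'rV[R]_N))%R]) (dens z)%:E < +oo)%E.
Proof.
pose A k := annulus 1 ((2 : R) ^+ k).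
have h1 k : 1 <= (2 : R) ^+ k by rewrite exprn_ege1// ler1n.
have h0 : 0 < (2 : R)^-1 by rewrite invr_gt0.
have pre k : scl 2^-1 @^-1` A k = annulus 2 ((2 : R) ^+ k.+1).
  by rewrite /A scale_annulus// invrK mul1r exprSr.
rewrite (_ : [set z | 1 <= enorm (z : 'rV[R]_N)] = \bigcup_k A k); last first.
  apply/seteqP; split => z /=; last by move=> [k _ /andP[]].
  move=> z1; exists (Num.truncn (enorm z)).+1 => //; apply/andP; split => //.
  apply: lt_le_trans (truncnS_gt _) _; rewrite -natrX ler_nat.
  exact/ltnW/ltn_expl.
apply: (@selfsimilar_ltry dens A (annulus 1 2) 2^-1 (2^-1 `^ (N%:R + 2 * s))) => //.
- exact: measurable_density.
- exact: density_ge0.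
- by move=> z; exact: density_scale.
- by move=> k; exact: measurable_annulus.
- exact: measurable_annulus.
- apply/seteqP; split => z //; rewrite /A /annulus/= expr0.
  by move=> /andP[/le_lt_trans /[apply]]; rewrite ltxx.
- by move=> k; rewrite pre annulusU ?ler1n// exprS ler_peMr.
- by move=> k; rewrite pre annulus_disj.
- rewrite invrK.
  have -> : (2 : R)^-1 `^ (N%:R + 2 * s) = (2 `^ (N%:R + 2 * s))^-1.
    by rewrite -powR_inv1// -powRrM mulN1r powRN.
  rewrite two_powR_dimD invfM mulrAC -exprVn mulV2n mul1r invf_lt1 ?powR_gt0//.
  by apply: lt_le_trans two_powR_ge2; rewrite ltr1n.
- apply: (@integral_bounded_ltry _ _ (@CNs R N s / 1 `^ (N%:R + 2 * s)) 2) => //.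
  + exact: measurable_annulus.
  + exact: measurable_density.
  + exact: density_ge0.
  + by move=> z /andP[z1 _]; exact: density_le.
  + by move=> z /andP[_ /ltW].
- apply/nondecreasing_seqP => k; apply/subsetPset => z; rewrite /A /annulus/= => /andP[-> h].
  by apply: lt_le_trans h _; rewrite exprS ler_peMl ?exprn_ge0// ler1n.
Qed.

Lemma integrable_levy_weight : lam.-integrable setT (EFin \o levy_weight).
Proof.
apply/integrableP; split.
  by apply/measurable_EFinP; exact: measurable_levy_weight.
pose B : set (borelR R N) := [set z | 1 <= enorm (z : 'rV[R]_N)].
have mB : measurable B by exact: measurable_enorm_ge.
have TE : [set: borelR R N] = annulus 0 1 `|` B.
  apply/seteqP; split => // z _; rewrite /B/annulus/= enorm_ge0/=.
  by case: (ltP (enorm z) 1) => _; [left|right].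
have mW E : measurable_fun E (EFin \o levy_weight : borelR R N -> _).
  by apply/measurable_EFinP; apply: measurable_funTS; exact: measurable_levy_weight.
rewrite (eq_integral (EFin \o levy_weight)); last first.
  by move=> z _; rewrite gee0_abs// lee_fin levy_weight_ge0.
rewrite TE ge0_integral_setU//; last 3 first.
- exact: measurable_annulus.
- by move=> z _; rewrite /= lee_fin levy_weight_ge0.
- by apply/disj_setPS => z [] /andP[_ z1]; rewrite /B/= leNgt z1.
apply: lte_add_pinfty.
  apply: le_lt_trans integral_sqr_density_ltry; apply: ge0_le_integral => //.
  - exact: measurable_annulus.
  - by move=> z _; rewrite lee_fin levy_weight_ge0.
  - apply/measurable_EFinP; apply: measurable_funTS.
    apply: measurable_funM; last exact: measurable_density.
    by apply: measurable_funX; exact: measurable_enorm.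
  - by move=> z _; rewrite lee_fin ler_wpM2r ?density_ge0// ge_min lexx.
apply: le_lt_trans integral_density_ltry; apply: ge0_le_integral => //.
- by move=> z _; rewrite lee_fin levy_weight_ge0.
- by apply/measurable_EFinP; apply: measurable_funTS; exact: measurable_density.
- by move=> z _; rewrite lee_fin ler_piMl ?density_ge0// ge_min lexx orbT.
Qed.

End LevyDensity.

(** * Integrals against the Levy measure *)

Section LevyIntegral.
Context {R : realType} {N : nat} (s : R).
Hypothesis s12 : 2^-1 < s < 1.
Hypothesis C0 : 0 < @CNs R N s.

Notation lam := (lebesgue_rV R N).
Notation dens := (@mu_density R N s).
Implicit Types (D : set (borelR R N)) (f g : borelR R N -> R).

Definition levy_integrable D f : Prop :=
  lam.-integrable D (EFin \o (fun z => f z * dens z)).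

Definition levy_mass : R := \int[lam]_(z in setT) (@levy_weight R N s z).

Lemma levy_mass_ge0 : 0 <= levy_mass.
Proof. by apply: Rintegral_ge0 => z _; exact: levy_weight_ge0. Qed.

Lemma levy_integrable_bounded D f C : measurable D ->
  measurable_fun [set: borelR R N] f ->
  (forall z, D z -> `|f z| <= C * Num.min (enorm (z : 'rV[R]_N) ^+ 2) 1) ->
  levy_integrable D f.
Proof.
move=> mD mf fC.
have iW : lam.-integrable D (fun z => C%:E * (EFin \o @levy_weight R N s) z)%E.
  apply: integrableZl => //; apply: integrableS (integrable_levy_weight s12 C0) => //.
apply: le_integrable iW => //.
  apply/measurable_EFinP; apply: measurable_funTS; apply: measurable_funM => //.
  exact: measurable_density.
move=> z Dz /=; rewrite lee_fin /levy_weight [C * _]mulrA.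
rewrite [`|f z * dens z|]normrM [`|_ * dens z|]normrM.
rewrite (ger0_norm (density_ge0 C0 z)).
rewrite ler_wpM2r ?density_ge0//; apply: le_trans (fC _ Dz) _; exact: ler_norm.
Qed.

Lemma levy_integrableD D f g : measurable D ->
  levy_integrable D f -> levy_integrable D g -> levy_integrable D (fun z => f z + g z).
Proof.
move=> mD fi gi; rewrite /levy_integrable.
rewrite (_ : _ \o _ = ((EFin \o (fun z => (f z * dens z)%R)) \+
  (EFin \o (fun z => (g z * dens z)%R)))%E).
  exact: integrableD.
by apply/funext => z /=; rewrite [in LHS]mulrDl.
Qed.

Lemma levy_integrableZ D f k : measurable D ->
  levy_integrable D f -> levy_integrable D (fun z => k * f z).
Proof.
move=> mD fi; rewrite /levy_integrable.
rewrite (_ : _ \o _ = (fun z => k%:E * (EFin \o (fun z => (f z * dens z)%R)) z)%E).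
  exact: integrableZl.
by apply/funext => z /=; rewrite -[in LHS]mulrA.
Qed.

Lemma mu_intD D f g : measurable D -> levy_integrable D f -> levy_integrable D g ->
  mu_int s D (fun z => f z + g z) = mu_int s D f + mu_int s D g.
Proof.
move=> mD fi gi; rewrite /mu_int -RintegralD//.
by apply: eq_Rintegral => z _; rewrite mulrDl.
Qed.

Lemma mu_intZ D f k : measurable D -> levy_integrable D f ->
  mu_int s D (fun z => k * f z) = k * mu_int s D f.
Proof.
move=> mD fi; rewrite /mu_int -RintegralZl//.
by apply: eq_Rintegral => z _; rewrite mulrA.
Qed.

Lemma le_mu_int D f g : measurable D -> levy_integrable D f -> levy_integrable D g ->
  (forall z, D z -> f z <= g z) -> mu_int s D f <= mu_int s D g.
Proof.
move=> mD fi gi fg; apply: le_Rintegral => // z Dz.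
by rewrite ler_wpM2r ?density_ge0// fg.
Qed.

Lemma eq_mu_int D f g : (forall z, D z -> f z = g z) -> mu_int s D f = mu_int s D g.
Proof.
by move=> fg; apply: eq_Rintegral => z /set_mem Dz; rewrite fg.
Qed.

Lemma normr_mu_int_le D f C : 0 <= C -> measurable D ->
  measurable_fun [set: borelR R N] f ->
  (forall z, D z -> `|f z| <= C * Num.min (enorm (z : 'rV[R]_N) ^+ 2) 1) ->
  `|mu_int s D f| <= C * levy_mass.
Proof.
move=> C_ge0 mD mf fC.
have iW := integrable_levy_weight s12 C0.
have iWD : lam.-integrable D (EFin \o @levy_weight R N s) by apply: integrableS iW.
have fi : levy_integrable D f by exact: levy_integrable_bounded fC.
apply: le_trans (le_normr_Rintegral mD fi) _.
apply: (@le_trans _ _ (\int[lam]_(z in D) (C * @levy_weight R N s z))).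
  apply: le_Rintegral => //.
  - exact: (integrable_norm fi).
  - exact: (integrableZl mD C iWD).
  - move=> z Dz; rewrite [`|f z * dens z|]normrM (ger0_norm (density_ge0 C0 z)).
    rewrite /levy_weight mulrA.
    by rewrite ler_wpM2r ?density_ge0// fC.
rewrite RintegralZl// ler_wpM2l// /levy_mass /Rintegral fine_le//.
- exact: integrable_fin_num.
- exact: integrable_fin_num.
- apply: ge0_subset_integral => //.
    by apply/measurable_EFinP; exact: measurable_levy_weight.
  by move=> z _; rewrite lee_fin levy_weight_ge0.
Qed.

Lemma mu_int_isometry (O : 'rV[R]_N -> 'rV[R]_N) D f :
  {morph O : x y / x + y} -> (forall z, enorm (O z) = enorm z) ->
  (forall x, exists y, O y = x) -> measurable D ->
  measurable_fun [set: borelR R N] f ->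
  mu_int s (O @^-1` D) (fun z => f (O z)) = mu_int s D f.
Proof.
move=> OD Oe Os mD mf; rewrite /mu_int /Rintegral; congr fine.
have mO := measurable_isometry OD Oe.
have mfd : measurable_fun D (fun z => (f z * dens z)%:E).
  apply/measurable_EFinP; apply: measurable_funTS; apply: measurable_funM => //.
  exact: measurable_density.
apply: etrans (integral_invariant mO
  (fun A mA => lebesgue_rV_isometry OD Oe Os mA) mD mfd).
by apply: eq_integral => z _; rewrite /mu_density Oe.
Qed.

Lemma mu_int_gt0 D f (U : set 'rV[R]_N) x : measurable D ->
  measurable_fun [set: borelR R N] f -> levy_integrable D f ->
  (forall z, D z -> 0 <= f z) -> open U -> U x -> U `<=` D ->
  (forall z, U z -> z != 0) -> (forall z, U z -> 0 < f z) -> 0 < mu_int s D f.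
Proof.
move=> mD mf fi f0 oU Ux UD U0 Uf.
have g0 z : D z -> 0 <= f z * dens z by move=> Dz; rewrite mulr_ge0 ?f0 ?density_ge0.
rewrite lt_neqAle Rintegral_ge0// andbT eq_sym; apply/eqP => /esym I0.
have fin := integrable_fin_num mD fi.
have Ie : (\int[lam]_(z in D) `|(EFin \o (fun z => (f z * dens z)%R)) z| = 0)%E.
  transitivity (\int[lam]_(z in D) (EFin \o (fun z => (f z * dens z)%R)) z)%E.
    by apply: eq_integral => z /set_mem Dz; rewrite gee0_abs// lee_fin g0.
  by rewrite -(fineK fin); congr (_%:E); exact: esym I0.
have mfd : measurable_fun D (EFin \o (fun z => f z * dens z)).
  apply/measurable_EFinP; apply: measurable_funTS; apply: measurable_funM => //.
  exact: measurable_density.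
have [A [mA A0 DA]] := (ae_eq_integral_abs lam mD mfd).1 Ie.
have := lebesgue_rV_open_gt0 oU Ux; rewrite lt_neqAle => /andP[/eqP + _]; apply.
apply/esym; apply: subset_measure0 mA _ A0; first exact: open_measurable_rV.
move=> z Uz; apply: DA => /= /(_ (UD _ Uz)) [] /eqP.
by rewrite gt_eqF// mulr_gt0 ?Uf// density_gt0// U0.
Qed.

End LevyIntegral.

(** * Cones and their first moments *)

Section Cones.
Context {R : realType} {N : nat} (s alpha : R).
Hypothesis s12 : 2^-1 < s < 1.
Hypothesis C0 : 0 < @CNs R N s.
Hypothesis alpha_bnd : 0 < alpha <= pi / 2.

Notation lam := (lebesgue_rV R N).
Notation dens := (@mu_density R N s).
Notation T a y := (cone alpha a%:E +oo%E y : set (borelR R N)).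
Implicit Types (y q : 'rV[R]_N) (f : borelR R N -> R).

Lemma dotr_unit y : enorm y = 1 -> dotr y y = 1.
Proof. by move=> y1; rewrite -sqr_enorm y1 expr1n. Qed.

Let alpha_itv : alpha \in `[0, pi].
Proof.
have /andP[a0 a1] := alpha_bnd.
rewrite in_itv/= (ltW a0) (le_trans a1)// ler_pdivrMr// ler_peMr ?pi_ge0//.
by rewrite ler1n.
Qed.

Lemma cos_alpha_ge0 : 0 <= cos alpha.
Proof.
have /andP[a0 a1] := alpha_bnd; apply: cos_ge0_pihalf; rewrite a1 andbT.
by rewrite (le_trans _ (ltW a0))// oppr_le0 divr_ge0// pi_ge0.
Qed.

Lemma cos_alpha_lt1 : cos alpha < 1.
Proof.
have /andP[a0 a1] := alpha_bnd.
by rewrite -cos0 ltr_cos// in_itv/= lexx pi_ge0.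
Qed.

(** In this form the cone is visibly open, and an isometry that matches the axes
    visibly matches the cones. *)
Lemma coneP (a : R) y (z : 'rV[R]_N) : 0 <= a -> enorm y = 1 ->
  T a y z <-> cos alpha * enorm z < dotr y z /\ a < enorm z.
Proof.
move=> a0 y1; rewrite /cone/= ltry andbT lte_fin.
suff H : a < enorm z -> (angle y z < alpha) = (cos alpha * enorm z < dotr y z).
  by split=> -[h az]; split => //; move: h; rewrite H.
move=> az; have z0 : 0 < enorm z by exact: le_lt_trans az.
rewrite /angle y1 mul1r -ltr_pdivlMr//; set u := dotr y z / enorm z.
have u1 : u \in `[(-1), 1].
  rewrite in_itv/= -ler_norml normrM normfV (gtr0_norm z0) ler_pdivrMr//.
  by rewrite (le_trans (normr_dotr_le _ _))// y1.
have u1' : -1 <= u <= 1 by move: u1; rewrite in_itv.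
rewrite -{2}(acosK u1) ltr_cos// in_itv/=.
by rewrite acos_ge0// acos_lepi.
Qed.

Lemma open_cone (a : R) y : 0 <= a -> enorm y = 1 -> open (T a y).
Proof.
move=> a0 y1.
rewrite (_ : T a y = (fun z => dotr y z - cos alpha * enorm z) @^-1` [set t | 0 < t]
   `&` @enorm R N @^-1` [set t | a < t]).
  apply: openI; (apply: open_comp; last exact: open_gt) => z _; last exact: continuous_enorm.
  apply: continuousB; first exact: continuous_dotr.
  by apply: continuousM; [exact: cst_continuous|exact: continuous_enorm].
by apply/seteqP; split => z /=; rewrite subr_gt0;
  [move/(coneP _ a0 y1)|move=> h; apply/(coneP _ a0 y1)].
Qed.

Lemma measurable_cone (a : R) y : 0 <= a -> enorm y = 1 -> measurable (T a y).
Proof. by move=> a0 y1; apply: open_measurable_rV; exact: open_cone. Qed.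

Lemma mu_int_cone_isometry (O : 'rV[R]_N -> 'rV[R]_N) (a : R) y y' f :
  {morph O : x y / x + y} -> (forall z, enorm (O z) = enorm z) ->
  (forall x, exists y, O y = x) -> (forall z, dotr y' (O z) = dotr y z) ->
  0 <= a -> enorm y = 1 -> enorm y' = 1 -> measurable_fun [set: borelR R N] f ->
  mu_int s (T a y') f = mu_int s (T a y) (fun z => f (O z)).
Proof.
move=> OD Oe Os Oy a0 y1 y'1 mf.
rewrite -(mu_int_isometry s OD Oe Os (measurable_cone a0 y'1) mf).
rewrite (_ : O @^-1` T a y' = T a y)//.
by apply/seteqP; split => z; move=> /(coneP _ a0) h; apply/(coneP _ a0) => //;
  [have := h y'1|have := h y1]; rewrite Oe Oy.
Qed.

Lemma mu_int_coneN (a : R) y f : 0 <= a -> enorm y = 1 ->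
  measurable_fun [set: borelR R N] f ->
  mu_int s (T a (- y)) f = mu_int s (T a y) (fun z => f (- (z : 'rV[R]_N))).
Proof.
move=> a0 y1 mf; apply: (@mu_int_cone_isometry -%R) => //.
- by move=> u v; rewrite opprD.
- by move=> z; rewrite enormN.
- by move=> x; exists (- x); rewrite opprK.
- by move=> z; rewrite dotrNl dotrNr opprK.
- by rewrite enormN.
Qed.

Lemma mu_int_cone_rotation (a : R) y y' f : 0 <= a -> enorm y = 1 -> enorm y' = 1 ->
  1 + dotr y y' != 0 -> measurable_fun [set: borelR R N] f ->
  mu_int s (T a y') f = mu_int s (T a y) (fun z => f (rotation y y' (z : 'rV[R]_N))).
Proof.
move=> a0 y1 y'1 yy' mf; apply: mu_int_cone_isometry => //.
- exact: rotationD.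
- by move=> z; exact: enorm_rotation.
- by move=> x; exists (rotation y' y x); rewrite rotationK// dotrC.
- by move=> z; exact: dotr_rotation.
Qed.

Lemma opp_of_dotr y y' : enorm y = 1 -> enorm y' = 1 -> 1 + dotr y y' = 0 -> y' = - y.
Proof.
move=> y1 y'1 yy'; apply/eqP; rewrite -addr_eq0 -enorm_eq0 -sqrf_eq0 sqr_enorm.
rewrite !dotrE (dotrC y' y) !dotr_unit//; apply/eqP.
by transitivity (2 * (1 + dotr y y')); [ring|rewrite yy' mulr0].
Qed.

Lemma sqr_enorm_unitB y y' : enorm y = 1 -> enorm y' = 1 ->
  enorm (y' - y) ^+ 2 = 2 * dotr y (y - y').
Proof.
by move=> y1 y'1; rewrite sqr_enorm !dotrE !dotr_unit// (dotrC y' y); ring.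
Qed.

Lemma levy_integrable_away (a : R) (D : set (borelR R N)) f M : 0 < a -> measurable D ->
  measurable_fun [set: borelR R N] f ->
  (forall z, D z -> a <= enorm (z : 'rV[R]_N)) -> (forall z, D z -> `|f z| <= M) ->
  levy_integrable s D f.
Proof.
move=> a0 mD mf Da fM; set m := Num.min (a ^+ 2) 1.
have m0 : 0 < m by rewrite lt_min exprn_gt0//=.
apply: (@levy_integrable_bounded _ _ _ s12 C0 _ _ (M / m)) => // z Dz.
rewrite mulrAC ler_pdivlMr//; apply: ler_pM => //; rewrite ?(ltW m0) ?fM//.
rewrite le_min !ge_min lexx orbT andbT; apply/orP; left.
by rewrite ler_pXn2r ?nnegrE ?enorm_ge0 ?Da// ltW.
Qed.

(** Truncating the linear form separates the divergence of its integral at the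
    origin from its growth at infinity. *)
Definition truncated_dotr (rho : R) q : borelR R N -> R :=
  fun z => if enorm (z : 'rV[R]_N) < rho then dotr q z else 0.

Lemma measurable_truncated_dotr rho q :
  measurable_fun [set: borelR R N] (truncated_dotr rho q).
Proof.
apply: measurable_fun_if => //.
- apply: (measurable_fun_bool true).
  rewrite setTI (_ : _ @^-1` _ = [set z | `]-oo, rho[%classic (enorm z)]).
    by apply: measurable_enorm_set; exact: measurable_itv.
  by apply/seteqP; split => z /=; rewrite in_itv.
- by apply: measurable_funTS; exact: measurable_dotr.
Qed.

Lemma normr_truncated_dotr_le rho q z : 0 <= rho ->
  `|truncated_dotr rho q z| <= enorm q * rho.
Proof.
move=> rho0; rewrite /truncated_dotr; case: ifPn => [zr|_].
  by apply: le_trans (normr_dotr_le _ _) _; rewrite ler_wpM2l ?enorm_ge0// ltW.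
by rewrite normr0 mulr_ge0// enorm_ge0.
Qed.

Lemma levy_integrable_cone (a : R) y f M : 0 < a -> enorm y = 1 ->
  measurable_fun [set: borelR R N] f -> (forall z, `|f z| <= M) ->
  levy_integrable s (T a y) f.
Proof.
move=> a0 y1 mf fM; apply: (@levy_integrable_away a _ _ M) => //.
  by apply: measurable_cone => //; exact: ltW.
by move=> z /(coneP _ (ltW a0) y1)[_ /ltW].
Qed.

Definition axis_reflection y z : 'rV[R]_N := (2 * dotr y z) *: y - z.

(** Reflecting across the axis of the cone averages z to its component
    along the axis. *)
Lemma mu_int_truncated_dotr (a rho : R) y q : 0 < a -> 0 <= rho -> enorm y = 1 ->
  mu_int s (T a y) (truncated_dotr rho q) =
  dotr q y * mu_int s (T a y) (truncated_dotr rho y).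
Proof.
move=> a0 rho0 y1; have dy := dotr_unit y1.
have Se z : enorm (axis_reflection y z) = enorm z.
  rewrite /enorm; congr Num.sqrt; rewrite /axis_reflection !dotrE dy (dotrC z y); ring.
have Sy z : dotr y (axis_reflection y z) = dotr y z.
  by rewrite /axis_reflection !dotrE dy; ring.
have SK z : axis_reflection y (axis_reflection y z) = z.
  by rewrite {1}/axis_reflection Sy /axis_reflection; apply/rowP => i; rewrite !mxE; ring.
have SD : {morph axis_reflection y : u v / u + v}.
  by move=> u v; apply/rowP => i; rewrite !mxE !dotrE; ring.
have mT := measurable_cone (ltW a0) y1.
have mq := measurable_truncated_dotr rho q.
have iq u : levy_integrable s (T a y) (truncated_dotr rho u).
  apply: (@levy_integrable_cone _ _ _ (enorm u * rho)) => //.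
    exact: measurable_truncated_dotr.
  by move=> z; exact: normr_truncated_dotr_le.
have iqS : levy_integrable s (T a y) (fun z => truncated_dotr rho q (axis_reflection y z)).
  apply: (@levy_integrable_cone _ _ _ (enorm q * rho)) => //.
    apply: measurableT_comp mq _.
    exact: measurable_isometry.
  by move=> z; exact: normr_truncated_dotr_le.
have E : mu_int s (T a y) (truncated_dotr rho q) =
    mu_int s (T a y) (fun z => truncated_dotr rho q (axis_reflection y z)).
  apply: mu_int_cone_isometry => //; last exact: ltW.
  by move=> x; exists (axis_reflection y x).
suff : mu_int s (T a y) (truncated_dotr rho q) + mu_int s (T a y) (truncated_dotr rho q) =
  2 * (dotr q y * mu_int s (T a y) (truncated_dotr rho y)) by lra.
rewrite {2}E -mu_intD// mulrA -mu_intZ//; apply: eq_mu_int => z _.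
rewrite /truncated_dotr Se; case: ifP => _; last by rewrite mulr0 addr0.
by rewrite /axis_reflection !dotrE; ring.
Qed.

Lemma mu_int_truncated_dotr_axis (a rho : R) y y' : 0 < a -> enorm y = 1 -> enorm y' = 1 ->
  mu_int s (T a y') (truncated_dotr rho y') = mu_int s (T a y) (truncated_dotr rho y).
Proof.
move=> a0 y1 y'1; have m := measurable_truncated_dotr rho y'.
have [/(opp_of_dotr y1 y'1) yy'|yy'] := eqVneq (1 + dotr y y') 0.
  rewrite {1}yy' mu_int_coneN ?(ltW a0)//; apply: eq_mu_int => z _.
  by rewrite /truncated_dotr enormN yy' dotrNl dotrNr opprK.
rewrite (mu_int_cone_rotation (ltW a0) y1 y'1 yy' m); apply: eq_mu_int => z _.
by rewrite /truncated_dotr enorm_rotation// dotr_rotation.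
Qed.

Lemma cone_mass_axis (a : R) y y' : 0 < a -> enorm y = 1 -> enorm y' = 1 ->
  mu_int s (T a y') (cst 1) = mu_int s (T a y) (cst 1).
Proof.
move=> a0 y1 y'1.
have [/(opp_of_dotr y1 y'1) yy'|yy'] := eqVneq (1 + dotr y y') 0.
  by rewrite yy' mu_int_coneN ?(ltW a0).
by rewrite (mu_int_cone_rotation (ltW a0) y1 y'1 yy').
Qed.

(** The normalization in the average operator is by a positive number, since the
    cone is open and nonempty. *)
Lemma cone_mass_gt0 (a : R) y : 0 < a -> enorm y = 1 -> 0 < mu_int s (T a y) (cst 1).
Proof.
move=> a0 y1; have dy := dotr_unit y1.
apply: (@mu_int_gt0 _ _ _ C0 _ _ (T a y) ((a + 1) *: y)) => //.
- by apply: measurable_cone => //; exact: ltW.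
- by apply: (@levy_integrable_cone _ _ _ 1) => // z; rewrite normr1.
- by apply: open_cone => //; exact: ltW.
- have a1 : 0 < a + 1 by rewrite addr_gt0.
  apply/(coneP _ (ltW a0) y1); rewrite enormZ y1 mulr1 (gtr0_norm a1) ltrDl ltr01; split => //.
  by rewrite dotrZr dy mulr1 gtr_pMl// cos_alpha_lt1.
- by move=> z /(coneP _ (ltW a0) y1)[_ az]; rewrite -enorm_gt0 (lt_trans a0).
Qed.

(** This is where s > 1/2 enters: halving shells of the cone toward the origin
    multiplies their first moment by 2^(2s-1) >= 1, so the moments of k
    successive shells add up to at least k times the first one. *)
Lemma moment_diverges (rho : R) y M : 0 < rho -> enorm y = 1 ->
  exists2 d : R, 0 < d & forall a, 0 < a < d ->
    M <= mu_int s (T a y) (truncated_dotr rho y).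
Proof.
move=> rho0 y1; have dy := dotr_unit y1.
pose g : borelR R N -> R := fun z => `|dotr y z| * dens z.
pose K : set (borelR R N) := [set z | cos alpha * enorm (z : 'rV[R]_N) < dotr y z].
pose A k : set (borelR R N) := K `&` annulus (rho * 2^-1 ^+ k) rho.
pose B : set (borelR R N) := K `&` annulus (rho * 2^-1) rho.
have oK : open (K : set 'rV[R]_N).
  rewrite (_ : K = (fun z => dotr y z - cos alpha * enorm z) @^-1` [set t | 0 < t]).
    apply: open_comp => [z _|]; last exact: open_gt.
    apply: continuousB; first exact: continuous_dotr.
    by apply: continuousM; [exact: cst_continuous|exact: continuous_enorm].
  by apply/seteqP; split => z; rewrite /K/= subr_gt0.
have mK : measurable K by exact: open_measurable_rV.
have mA k : measurable (A k) by apply: measurableI => //; exact: measurable_annulus.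
have mB : measurable B by apply: measurableI => //; exact: measurable_annulus.
have mabs : measurable_fun [set: borelR R N] (fun z : borelR R N => `|dotr y z|).
  by apply: measurableT_comp => //; exact: measurable_dotr.
have mg : measurable_fun [set: borelR R N] g.
  by apply: measurable_funM => //; exact: measurable_density.
have g0 z : 0 <= g z by rewrite mulr_ge0// density_ge0.
have v0 : 0 < (2 : R)^-1 by rewrite invr_gt0.
have v1 : (2 : R)^-1 <= 1 by rewrite invf_le1// ler1n.
have pre k : (fun z : 'rV[R]_N => 2 *: z) @^-1` A k =
    K `&` annulus (rho * 2^-1 ^+ k.+1) (rho * 2^-1).
  rewrite /A preimage_setI scale_annulus// exprSr mulrA; congr (_ `&` _).
  apply/seteqP; split => z; rewrite /K/= enormZ (ger0_norm (ler0n _ 2)) dotrZr mulrCA;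
    by rewrite ltr_pM2l.
have ge k : (k%:R%:E * \int[lam]_(z in B) (g z)%:E <=
    \int[lam]_(z in A k) (g z)%:E)%E.
  apply: (@selfsimilar_ge R N g A B 2 (2 `^ (N%:R + 2 * s) / 2)) => //.
  - move=> z; rewrite /g (@density_scale R N s 2 z)// dotrZr normrM (ger0_norm (ler0n _ 2)).
    by field.
  - move=> j; rewrite pre -setIUr setUC annulusU//.
      by rewrite ler_pM2l// exprS ler_piMr ?exprn_ile1 ?(ltW v0).
    by rewrite ler_piMr// ltW.
  - move=> j; rewrite pre; apply/disj_setPS => z [] [_ /andP[h _]] [_ /andP[_]].
    by rewrite ltNge h.
  - have V : (2 : R)^-1 ^+ N * 2 ^+ N = 1 by rewrite -exprMn mulVf ?expr1n.
    rewrite two_powR_dimD [leRHS](_ : _ =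
      (2^-1 ^+ N * 2 ^+ N) * (2 `^ (2 * s) / 2)); last by ring.
    by rewrite V mul1r ler_pdivlMr// mul1r two_powR_ge2.
have Bball z : B z -> rho * 2^-1 <= enorm (z : 'rV[R]_N) /\ enorm (z : 'rV[R]_N) < rho.
  by case=> _ /andP[].
have iB : levy_integrable s B (fun z => `|dotr y z|).
  apply: (@levy_integrable_away (rho * 2^-1) _ _ rho) => //.
  - by rewrite mulr_gt0.
  - by move=> z /Bball[].
  - move=> z /Bball[_ zr]; rewrite normr_id (le_trans (normr_dotr_le _ _))//.
    by rewrite y1 mul1r ltW.
set b := mu_int s B (fun z => `|dotr y z|).
have b0 : 0 < b.
  pose U : set 'rV[R]_N := K `&` (@enorm R N @^-1` [set t | rho * 2^-1 < t] `&`
    @enorm R N @^-1` [set t | t < rho]).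
  have U0 z : U z -> 0 < enorm z.
    by move=> [_ [/= zr _]]; rewrite (lt_trans _ zr)// mulr_gt0.
  apply: (@mu_int_gt0 _ _ _ C0 _ _ U ((rho * (3 / 4)) *: y)) => //.
  - apply: openI => //; apply: openI; apply: open_comp.
    + by move=> z _; exact: continuous_enorm.
    + exact: open_gt.
    + by move=> z _; exact: continuous_enorm.
    + exact: open_lt.
  - have r0 : 0 < rho * (3 / 4) by rewrite mulr_gt0.
    rewrite /U /K; split => /=.
      by rewrite enormZ y1 mulr1 (gtr0_norm r0) dotrZr dy mulr1 gtr_pMl// cos_alpha_lt1.
    by rewrite enormZ y1 mulr1 (gtr0_norm r0); split; [rewrite ltr_pM2l//; lra|
      rewrite gtr_pMr//; lra].
  - by move=> z [Kz [/= h1 h2]]; split => //; apply/andP; split => //; exact: ltW.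
  - by move=> z Uz; rewrite -enorm_gt0 U0.
  - move=> z Uz; rewrite normr_gt0 gt_eqF//; case: (Uz) => Kz _.
    by apply: le_lt_trans Kz; rewrite mulr_ge0 ?cos_alpha_ge0// enorm_ge0.
have Efin : (\int[lam]_(z in B) (g z)%:E)%E = b%:E.
  by rewrite -(fineK (integrable_fin_num mB iB)).
pose k := (Num.truncn (M / b)).+1.
exists (rho * 2^-1 ^+ k); first by rewrite mulr_gt0// exprn_gt0.
move=> a /andP[a0 ak].
have kM : M <= k%:R * b by rewrite -ler_pdivrMr// ltW// truncnS_gt.
apply: le_trans kM _.
have mT := measurable_cone (ltW a0) y1.
have mt := measurable_truncated_dotr rho y.
have iT : levy_integrable s (T a y) (truncated_dotr rho y).
  apply: (@levy_integrable_cone _ _ _ (enorm y * rho)) => //.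
  by move=> z; apply: normr_truncated_dotr_le; exact: ltW.
have t0 z : T a y z -> 0 <= truncated_dotr rho y z.
  move=> /(coneP _ (ltW a0) y1)[h _]; rewrite /truncated_dotr; case: ifP => // _.
  by apply: le_trans (ltW h); rewrite mulr_ge0 ?cos_alpha_ge0// enorm_ge0.
rewrite -lee_fin EFinM -Efin; apply: le_trans (ge k) _.
rewrite [leRHS](_ : _ =
  \int[lam]_(z in T a y) (truncated_dotr rho y z * dens z)%:E)%E; last first.
  by rewrite -(fineK (integrable_fin_num mT iT)).
have AT : A k `<=` T a y.
  move=> z [Kz /andP[az _]]; apply/(coneP _ (ltW a0) y1); split => //.
  exact: lt_le_trans az.
rewrite (eq_integral (fun z => (truncated_dotr rho y z * dens z)%:E)); last first.
  move=> z /set_mem Akz; rewrite /g; congr (_ * _)%:E.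
  have zr : enorm (z : 'rV[R]_N) < rho by case: Akz => _ /andP[].
  have := t0 z (AT z Akz); rewrite /truncated_dotr zr => h; by rewrite ger0_norm.
apply: ge0_subset_integral => //.
  apply/measurable_EFinP; apply: measurable_funTS; apply: measurable_funM => //.
  exact: measurable_density.
by move=> z Tz; rewrite lee_fin mulr_ge0 ?t0// density_ge0.
Qed.

End Cones.

(** * Taylor expansion from partial derivatives *)

Section Calculus.
Context {R : realType} {n : nat}.
Implicit Types (f : 'rV[R]_n -> R) (x y z v : 'rV[R]_n).

Lemma is_derive_line f x v (t : R) : derivable f (t *: v + x) v ->
  is_derive t 1 (fun u : R => f (u *: v + x)) ('D_v f (t *: v + x)).
Proof.
have E : (fun h : R => h^-1 *: (((fun u : R => f (u *: v + x)) \o shift t) (h *: 1) -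
    f (t *: v + x))) =
  (fun h => h^-1 *: ((f \o shift (t *: v + x)) (h *: v) - f (t *: v + x))).
  apply/funext => h /=; congr (_ *: (f _ - _)).
  by rewrite scalerDl /GRing.scale/= mulr1 addrA.
by move=> df; split; [rewrite /derivable E|rewrite /derive E].
Qed.

Lemma mean_value_line f x v (b : R) : (forall y, derivable f y v) ->
  exists2 c : R, `|c| <= `|b| & f (b *: v + x) - f x = b * 'D_v f (c *: v + x).
Proof.
move=> df; pose h (u : R) := f (u *: v + x).
have dh (t : R) : is_derive t 1 h ('D_v f (t *: v + x)) by exact: is_derive_line.
have ch (i : interval R) : {within [set` i], continuous h}.
  apply: continuous_subspaceT => t.
  have [dt _] := dh t; exact/differentiable_continuous/derivable1_diffP.
have h0 : h 0 = f x by rewrite /h scale0r add0r.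
have [b0|b0] := leP 0 b.
  have [c + E] := MVT_segment b0 (fun t _ => dh t) (ch _).
  rewrite in_itv/= => /andP[c0 cb]; exists c; first by rewrite !ger0_norm.
  by rewrite -h0 -/(h b) E subr0 mulrC.
have [c + E] := MVT_segment (ltW b0) (fun t _ => dh t) (ch _).
rewrite in_itv/= => /andP[bc c0]; exists c; first by rewrite !ler0_norm ?(ltW b0)// lerN2.
by rewrite -h0 -/(h b) -[LHS]opprB E sub0r mulrN opprK mulrC.
Qed.

(** Moving from x to x + z one coordinate at a time, each step is a
    one-variable mean value theorem: no Frechet differential is involved. *)
Lemma mean_value_coord f x z : is_C1 f -> exists xi : 'I_n -> 'rV[R]_n,
  (forall i, enorm (xi i - x) <= enorm z) /\
  f (x + z) - f x = \sum_(i < n) z 0 i * partial i f (xi i).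
Proof.
move=> C1; pose w k : 'rV[R]_n := x + \row_j (if (j < k)%N then z 0 j else 0).
have wS (i : 'I_n) : w i.+1 = z 0 i *: ebasis i + w i.
  apply/rowP => j; rewrite !mxE ltnS; case: (ltngtP j i) => [ji|ij|ji].
  - by rewrite mulr0 add0r.
  - by rewrite mulr0 add0r.
  - by have -> : j = i by [exact: val_inj]; rewrite mulr1 addr0 addrC.
have step (i : 'I_n) : exists c : R, `|c| <= `|z 0 i| /\
    f (w i.+1) - f (w i) = z 0 i * partial i f (c *: ebasis i + w i).
  rewrite wS; have [c cz E] := mean_value_line (w i) (z 0 i) (proj1 (C1 i)).
  by exists c.
pose c i := sval (cid (step i)).
exists (fun i => c i *: ebasis i + w i); split.
  move=> i; have [cz _] := svalP (cid (step i)); rewrite -/(c i) in cz.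
  rewrite /enorm ler_sqrt ?dotr_ge0// /dotr; apply: ler_sum => j _.
  rewrite -!expr2 -real_normK ?num_real// -[leRHS]real_normK ?num_real//.
  rewrite ler_pXn2r ?nnegrE// !mxE.
  case: (ltngtP j i) => [ji|ij|ji].
  - by rewrite mulr0 add0r addrAC subrr add0r.
  - by rewrite mulr0 add0r addr0 subrr normr0.
  - by have -> : j = i by [exact: val_inj]; rewrite mulr1 addr0 addrK.
rewrite (_ : x + z = w n); last first.
  by apply/rowP => j; rewrite !mxE ltn_ord.
rewrite (_ : f x = f (w 0%N)); last first.
  by congr f; apply/rowP => j; rewrite !mxE addr0.
rewrite -(telescope_sumr (fun k => f (w k)))// big_mkord; apply: eq_bigr => i _.
by have [_ ->] := svalP (cid (step i)).
Qed.

Lemma common_radius (d : 'I_n -> R) : (forall i, 0 < d i) ->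
  exists2 e : R, 0 < e & forall i, e <= d i.
Proof.
move=> d0; pose S := \sum_i (d i)^-1.
have S0 : 0 <= S by apply: sumr_ge0 => i _; rewrite invr_ge0 ltW.
have S1 : 0 < S + 1 by rewrite ltr_wpDl.
exists (S + 1)^-1; first by rewrite invr_gt0.
move=> i; rewrite -[leRHS]invrK lef_pV2 ?posrE ?invr_gt0//.
rewrite /S (bigD1 i)//= -addrA lerDl addr_ge0// sumr_ge0// => j _.
by rewrite invr_ge0 ltW.
Qed.

Lemma C1_locally_lipschitz f x : is_C1 f -> exists M d : R, [/\ 0 <= M, 0 < d &
  forall y z, enorm (y - x) < d -> enorm z < d -> `|f (y + z) - f y| <= M * enorm z].
Proof.
move=> C1.
have loc i : exists d : R, 0 < d /\
    forall y, enorm (y - x) < d -> `|partial i f y - partial i f x| < 1.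
  have [_ ci] := C1 i.
  have [d d0 dP] := (continuous_enormP (partial i f) x).1 (ci x) 1 ltr01.
  by exists d.
have [e e0 ed] := common_radius (fun i => (svalP (cid (loc i))).1).
pose M := \sum_i (`|partial i f x| + 1).
have M0 : 0 <= M by apply: sumr_ge0 => i _; rewrite addr_ge0.
exists M, (e / 2); split => //; first by rewrite divr_gt0.
move=> y z yx ze; have [xi [xiy ->]] := mean_value_coord y z C1.
apply: le_trans (ler_norm_sum _ _ _) _; rewrite /M mulr_suml; apply: ler_sum => i _.
rewrite normrM mulrC ler_pM//; last exact: coord_le_enorm.
have := (svalP (cid (loc i))).2 (xi i).
set d := sval _ => h.
have : enorm (xi i - x) < d.
  apply: lt_le_trans (ed i); apply: le_lt_trans (ler_enormB _ y _) _.
  by rewrite [ltRHS]splitr ltrD// (le_lt_trans (xiy i)).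
move/h => h1; rewrite -{1}(subrK (partial i f x) (partial i f (xi i))).
by apply: le_trans (ler_normD _ _) _; rewrite addrC lerD2l ltW.
Qed.

Lemma C1_continuous f : is_C1 f -> continuous f.
Proof.
move=> C1 x; apply/continuous_enormP => e e0.
have [M [d [M0 d0 H]]] := C1_locally_lipschitz x C1.
have M1 : 0 < M + 1 by rewrite ltr_wpDl.
have m0 : 0 < Num.min d (e / (M + 1)) by rewrite lt_min d0 divr_gt0.
exists (Num.min d (e / (M + 1))) => // y; rewrite lt_min => /andP[yd ye].
have := H x (y - x); rewrite subrr enorm0 => /(_ d0 yd); rewrite (addrC x) subrK.
move=> /le_lt_trans; apply; rewrite ltr_pdivlMr// in ye; apply: le_lt_trans ye.
by rewrite mulrC ler_wpM2l ?enorm_ge0// lerDl.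
Qed.

(** The error is a sum of increments of partial derivatives over a distance at
    most |z|, each locally Lipschitz. *)
Lemma C2_taylor f x : is_C2 f -> exists M d : R, [/\ 0 <= M, 0 < d &
  forall y z, enorm (y - x) < d -> enorm z < d ->
    `|f (y + z) - f y - dotr (grad f y) z| <= M * enorm z ^+ 2].
Proof.
move=> [C1 C2].
have loc i : exists Md : R * R, [/\ 0 <= Md.1, 0 < Md.2 & forall y z,
    enorm (y - x) < Md.2 -> enorm z < Md.2 ->
    `|partial i f (y + z) - partial i f y| <= Md.1 * enorm z].
  by have [M [d [M0 d0 H]]] := C1_locally_lipschitz x (C2 i); exists (M, d).
pose Md i := sval (cid (loc i)).
have MdP i := svalP (cid (loc i)).
have d0 i : 0 < (Md i).2 by have [] := MdP i.
have [e e0 ed] := common_radius d0.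
exists (\sum_i (Md i).1), e; split => //.
  by apply: sumr_ge0 => i _; have [] := MdP i.
move=> y z yx ze; have [xi [xiy ->]] := mean_value_coord y z C1.
rewrite /dotr -sumrB mulr_suml; apply: le_trans (ler_norm_sum _ _ _) _.
apply: ler_sum => i _; rewrite mxE mulrC -mulrBl normrM mulrC expr2 mulrA [leRHS]mulrC.
apply: ler_pM => //; first exact: coord_le_enorm.
have [M0 _ H] := MdP i.
have := H y (xi i - y) (lt_le_trans yx (ed i)) (lt_le_trans (le_lt_trans (xiy i) ze) (ed i)).
by rewrite [y + _]addrC subrK => /le_trans; apply; rewrite ler_wpM2l.
Qed.

Lemma continuous_grad f x : is_C1 f -> forall e : R, 0 < e ->
  exists2 d : R, 0 < d & forall y, enorm (y - x) < d -> enorm (grad f y - grad f x) < e.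
Proof.
move=> C1 e e0.
have e'0 : 0 < e / n.+1%:R by rewrite divr_gt0.
have loc i : exists d : R, 0 < d /\
    forall y, enorm (y - x) < d -> `|partial i f y - partial i f x| < e / n.+1%:R.
  have [_ ci] := C1 i.
  have [d d0 dP] := (continuous_enormP (partial i f) x).1 (ci x) _ e'0.
  by exists d.
have [d d0 ed] := common_radius (fun i => (svalP (cid (loc i))).1).
exists d => // y yx.
apply: le_lt_trans (enorm_le_normr _) _.
have : `|grad f y - grad f x| <= e / n.+1%:R.
  rewrite [leLHS]/Num.Def.normr/= mx_normrE; apply: bigmax_le; first exact: ltW.
  move=> [i j] _; rewrite !mxE ltW//.
  exact: (svalP (cid (loc j))).2 (lt_le_trans yx (ed j)).
move=> h; apply: (@le_lt_trans _ _ (n%:R * (e / n.+1%:R))); first exact: ler_wpM2l.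
by rewrite mulrCA gtr_pMr// ltr_pdivrMr// mul1r ltr_nat.
Qed.

Lemma near_eq_grad f g x : {near x, f =1 g} -> grad f x = grad g x.
Proof. by move=> fg; apply/rowP => i; rewrite !mxE; exact: near_eq_derive. Qed.

Lemma partialN f i : is_C1 f -> partial i (fun x => - f x) = (fun x => - partial i f x).
Proof. by move=> C1; apply/funext => x; exact: (deriveN ((C1 i).1 x)). Qed.

Lemma is_C1N f : is_C1 f -> is_C1 (fun x => - f x).
Proof.
move=> C1 i; have [df cf] := C1 i; split=> [x|].
  by have := derivableN (df x).
by rewrite partialN// => x; apply: continuousN; exact: cf.
Qed.

Lemma is_C2N f : is_C2 f -> is_C2 (fun x => - f x).
Proof.
by move=> [C1 C2]; split; [exact: is_C1N|move=> i; rewrite partialN//; exact: is_C1N].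
Qed.

End Calculus.

(** * The dynamic programming equation and the glued test function *)

Section TugOfWar.
Context {R : realType} {N : nat} (s alpha : R).
Hypothesis s12 : 2^-1 < s < 1.
Hypothesis C0 : 0 < @CNs R N s.
Hypothesis alpha_bnd : 0 < alpha <= pi / 2.

Notation lam := (lebesgue_rV R N).
Notation dens := (@mu_density R N s).
Notation T a y := (cone alpha a%:E +oo%E y : set (borelR R N)).

Lemma measurable_addl (f : 'rV[R]_N -> R) (x : 'rV[R]_N) :
  measurable_fun [set: borelR R N] (f : borelR R N -> R) ->
  measurable_fun [set: borelR R N] (fun z : borelR R N => f (x + (z : 'rV[R]_N))).
Proof.
move=> mf; have := measurableT_comp mf (measurable_funDV
  (measurable_cst (x : borelR R N)) (@measurable_id _ (borelR R N) setT)).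
exact.
Qed.

Lemma measurable_opprV : measurable_fun [set: borelR R N]
  ((fun z : 'rV[R]_N => - z) : borelR R N -> borelR R N).
Proof.
by apply: measurable_isometry => [u v|z]; [rewrite opprD|rewrite enormN].
Qed.

Lemma measurable_subl (f : 'rV[R]_N -> R) (x : 'rV[R]_N) :
  measurable_fun [set: borelR R N] (f : borelR R N -> R) ->
  measurable_fun [set: borelR R N] (fun z : borelR R N => f (x - (z : 'rV[R]_N))).
Proof.
move=> mf; have := measurableT_comp mf (measurable_funDV
  (measurable_cst (x : borelR R N)) measurable_opprV).
exact.
Qed.

(** The operator averages a supremum and an infimum. The supremum is nearly
    attained at some y', while any y bounds the infimum from above; clearing
    the common mass of the cones turns the equation u = A u into this
    inequality. *)
Lemma avg_op_near_sup (u : 'rV[R]_N -> R) (B a eta : R) (x e : 'rV[R]_N) :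
  0 < a -> 0 < eta -> enorm e = 1 ->
  measurable_fun [set: borelR R N] (u : borelR R N -> R) ->
  (forall z, `|u z| <= B) -> u x = avg_op s alpha a u x ->
  exists2 y', enorm y' = 1 & forall y, enorm y = 1 ->
    - eta <= mu_int s (T a y') (fun z => u (x + z) - u x)
           + mu_int s (T a y) (fun z => u (x + z) - u x).
Proof.
move=> a0 eta0 e1 mu uB uE; set m := mu_int s (T a e) (cst 1).
have m0 : 0 < m by exact: cone_mass_gt0.
have mass y : enorm y = 1 -> mu_int s (T a y) (cst 1) = m by move=> y1; exact: cone_mass_axis.
pose J y := mu_int s (T a y) (fun z => u (x + z)).
have mux := measurable_addl x mu.
have intc (c : R) y : enorm y = 1 -> levy_integrable s (T a y) (fun=> c).
  by move=> y1; apply: (@levy_integrable_cone _ _ _ _ s12 C0 alpha_bnd _ _ _ `|c|).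
have intu y : enorm y = 1 -> levy_integrable s (T a y) (fun z => u (x + z)).
  by move=> y1; apply: (@levy_integrable_cone _ _ _ _ s12 C0 alpha_bnd _ _ _ B).
have mT y : enorm y = 1 -> measurable (T a y).
  by move=> y1; apply: measurable_cone => //; exact: ltW.
have cstI (c : R) y : enorm y = 1 -> mu_int s (T a y) (fun=> c) = c * m.
  move=> y1; rewrite -(mass y y1) -(mu_intZ _ (mT y y1) (intc 1 y y1)).
  by apply: eq_mu_int => z _; rewrite mulr1.
have IE y : enorm y = 1 ->
    mu_int s (T a y) (fun z => u (x + z) - u x) = J y - u x * m.
  by move=> y1; rewrite -mulNr -(cstI _ y y1) -(mu_intD (mT y y1) (intu y y1) (intc _ y y1)).
have Jle y : enorm y = 1 -> `|J y| <= B * m.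
  move=> y1; rewrite ler_norml -mulNr -!(cstI _ y y1); apply/andP; split.
    apply: (le_mu_int C0 (mT y y1) (intc _ y y1) (intu y y1)).
    by move=> z _; have := uB (x + z); rewrite ler_norml => /andP[].
  apply: (le_mu_int C0 (mT y y1) (intu y y1) (intc _ y y1)).
  by move=> z _; have := uB (x + z); rewrite ler_norml => /andP[].
move: uE; rewrite /avg_op; set S := (X in sup X) => uE.
have SE y : enorm y = 1 -> S (m^-1 * J y).
  by move=> y1; exists y => //; rewrite /mu_avg mass.
have Sbd t : S t -> `|t| <= B.
  move=> [y y1 <-]; rewrite /mu_avg mass// normrM normfV (gtr0_norm m0) mulrC.
  by rewrite ler_pdivrMr// Jle.
have hasS : has_sup S.
  split; first by exists (m^-1 * J e); exact: SE.
  by exists B => t /Sbd; exact/le_trans/ler_norm.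
have [t [y' y'1 <-]] := sup_adherent (divr_gt0 eta0 m0) hasS.
rewrite /mu_avg mass// -/(J y') => sup_lt; exists y' => // y y1.
have infle : inf S <= m^-1 * J y.
  apply: ge_inf (SE y y1); exists (- B) => v /Sbd.
  by rewrite ler_norml => /andP[].
rewrite !IE//.
have h : 2 * u x <= m^-1 * J y' + eta / m + m^-1 * J y.
  by rewrite uE mulrA divff// mul1r lerD// -lerBlDr ltW.
have : 2 * u x * m <= (m^-1 * J y' + eta / m + m^-1 * J y) * m.
  by rewrite ler_pM2r.
have -> : (m^-1 * J y' + eta / m + m^-1 * J y) * m = J y' + eta + J y.
  by field; rewrite gt_eqF.
lra.
Qed.

Section TestFunction.
Variables (phi u : 'rV[R]_N -> R) (x : 'rV[R]_N) (r B : R).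
Hypotheses (r0 : 0 < r) (phiC2 : is_C2 phi) (cu : continuous u).
Hypothesis uB : forall y, `|u y| <= B.

Definition glued y : R := \1_(ecball x r) y * phi y + \1_(~` ecball x r) y * u y.

Lemma glued_in y : ecball x r y -> glued y = phi y.
Proof.
by move=> xy; rewrite /glued !indicE mem_set// mul1r memNset ?mul0r ?addr0//.
Qed.

Lemma glued_out y : ~ ecball x r y -> glued y = u y.
Proof. by move=> xy; rewrite /glued !indicE memNset// mul0r mem_set// mul1r add0r. Qed.

Let cphi : continuous phi. Proof. exact: C1_continuous (proj1 phiC2). Qed.

Lemma measurable_ecball : measurable (ecball x r : set (borelR R N)).
Proof.
rewrite (_ : ecball x r = (fun z => - x + z) @^-1` [set z | `]-oo, r]%classic (enorm z)]).
  apply: measurable_preimage_borel.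
    exact: (measurable_funDV (measurable_cst (- x : borelR R N))
      (@measurable_id _ (borelR R N) setT)).
  by apply: measurable_enorm_set; exact: measurable_itv.
by apply/seteqP; split => z /=; rewrite in_itv/= /ecball/= addrC.
Qed.

Lemma measurable_glued : measurable_fun [set: borelR R N] (glued : borelR R N -> R).
Proof.
apply: measurable_funD; apply: measurable_funM.
- exact: measurable_indic measurable_ecball.
- exact: continuous_measurable_rV.
- by apply: measurable_indic; apply: measurableC; exact: measurable_ecball.
- exact: continuous_measurable_rV.
Qed.

Lemma glued_bounded : exists C, forall y, `|glued y| <= C.
Proof.
have cA : compact (ecball x r) by exact: compact_ecball.
have A0 : ecball x r !=set0 by exists x; rewrite /ecball/= subrr enorm0 ltW.
have ct (f : 'rV[R]_N -> R) : continuous f -> {within ecball x r, continuous f}.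
  exact: continuous_subspaceT.
have [c1 _ h1] := EVT_max_rV A0 cA (ct _ cphi).
have [c2 _ h2] := EVT_min_rV A0 cA (ct _ cphi).
exists (B + `|phi c1| + `|phi c2|) => y.
have B0 : 0 <= B by apply: le_trans (uB x).
have [xy|xy] := pselect (ecball x r y).
  rewrite glued_in// ler_norml; apply/andP; split.
    apply: le_trans (h2 y (mem_set xy)).
    have := ler_norm (- phi c2); rewrite normrN => h; have := normr_ge0 (phi c1); lra.
  apply: le_trans (h1 y (mem_set xy)) _.
  have h := ler_norm (phi c1); have := normr_ge0 (phi c2); lra.
rewrite glued_out//; apply: le_trans (uB y) _.
by rewrite -addrA lerDl addr_ge0.
Qed.

Lemma glued_continuous y : enorm (y - x) != r -> {for y, continuous glued}.
Proof.
move=> yr; apply/continuous_enormP => e e0.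
have d0 : 0 < `|enorm (y - x) - r| by rewrite normr_gt0 subr_eq0.
have near_dist z : enorm (z - y) < `|enorm (y - x) - r| ->
    (enorm (z - x) <= r) = (enorm (y - x) <= r).
  move=> zy; have h : `|enorm (z - x) - enorm (y - x)| <= enorm (z - y).
    by apply: le_trans (ler_dist_enorm _ _) _; rewrite opprB addrA subrK.
  move: zy h; move: (enorm (z - x)) (enorm (y - x)) (enorm (z - y)) => b c d.
  case: (leP c r) => cr; [rewrite ler0_norm ?subr_le0//|rewrite gtr0_norm ?subr_gt0//];
    rewrite ler_norml => h1 /andP[h2 h3]; [apply/idP|apply/negbTE; rewrite -ltNge]; lra.
have [xy|xy] := boolP (enorm (y - x) <= r).
  have cy : {for y, continuous phi} by exact: cphi.
  have [d dp H] := (continuous_enormP phi y).1 cy e e0.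
  exists (Num.min d `|enorm (y - x) - r|); first by rewrite lt_min dp.
  move=> z; rewrite lt_min => /andP[zd /near_dist zr].
  by rewrite !glued_in//= ?H// /ecball/= zr.
have cy : {for y, continuous u} by exact: cu.
have [d dp H] := (continuous_enormP u y).1 cy e e0.
exists (Num.min d `|enorm (y - x) - r|); first by rewrite lt_min dp.
move=> z; rewrite lt_min => /andP[zd /near_dist zr].
by rewrite !glued_out//= ?H// /ecball/= ?zr; exact/negP.
Qed.

(** Near the contact point the glued function is its linearization up to a
    quadratic error, and far from it it is bounded; min(|z|^2, 1) controls
    both errors, uniformly in the base point. *)
Lemma glued_expansion : exists C rho : R, [/\ 0 <= C, 0 < rho &
  forall y z, enorm (y - x) < rho ->
   `|glued (y + z) - phi y - truncated_dotr rho (grad phi y) z|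
     <= C * Num.min (enorm z ^+ 2) 1].
Proof.
have [M [d [M0 d0 taylor]]] := C2_taylor x phiC2.
have [K gK] := glued_bounded.
have K0 : 0 <= K by apply: le_trans (gK x).
pose rho := Num.min (Num.min d (r / 2)) 1.
have rho0 : 0 < rho by rewrite !lt_min d0 ltr01 divr_gt0.
have rho_d : rho <= d by rewrite /rho !ge_min lexx.
have rho_r : rho <= r / 2 by rewrite /rho !ge_min lexx orbT.
have rho_1 : rho <= 1 by rewrite /rho ge_min lexx orbT.
exists (M + 2 * K / rho ^+ 2), rho; split => //.
  by rewrite addr_ge0// divr_ge0 ?sqr_ge0// mulr_ge0.
move=> y z yx; rewrite /truncated_dotr; case: ltP => zr.
  have z1 : enorm z ^+ 2 <= 1 by rewrite exprn_ile1 ?enorm_ge0// ltW// (lt_le_trans zr).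
  rewrite glued_in; last first.
    rewrite /ecball/=; apply: le_trans (ler_enormB _ y _) _.
    rewrite addrAC subrr add0r [leRHS]splitr lerD// ltW//.
      exact: lt_le_trans rho_r.
    exact: lt_le_trans rho_r.
  rewrite min_l//; apply: le_trans (taylor y z _ _) _.
  - exact: lt_le_trans rho_d.
  - exact: lt_le_trans rho_d.
  - by rewrite ler_wpM2r ?sqr_ge0// lerDl divr_ge0 ?sqr_ge0// mulr_ge0.
have phiy : phi y = glued y.
  rewrite glued_in// /ecball/= ltW// (lt_le_trans yx)// (le_trans rho_r)//.
  by rewrite ler_pdivrMr// ler_pMr// ler1n.
rewrite subr0; apply: (@le_trans _ _ (2 * K)).
  by rewrite phiy (le_trans (ler_normB _ _))// mulrDl mul1r lerD.
have h : rho ^+ 2 <= Num.min (enorm z ^+ 2) 1.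
  rewrite le_min exprn_ile1 ?(ltW rho0)// andbT.
  by rewrite ler_pXn2r ?nnegrE ?enorm_ge0// ltW.
apply: (@le_trans _ _ (2 * K / rho ^+ 2 * Num.min (enorm z ^+ 2) 1)).
  by rewrite mulrAC ler_pdivlMr ?exprn_gt0// ler_wpM2l// mulr_ge0.
by rewrite ler_wpM2r ?lerDr// le_min sqr_ge0 ler01.
Qed.

(** The linear parts of the two increments cancel. *)
Lemma glued_second_difference : exists C rho : R, [/\ 0 <= C, 0 < rho &
  forall y z, enorm (y - x) < rho ->
    `|(glued (y + z) - phi y) + (glued (y - z) - phi y)|
      <= C * Num.min (enorm z ^+ 2) 1].
Proof.
have [C [rho [C1 rho0 H]]] := glued_expansion.
exists (2 * C), rho; split => //; first by rewrite mulr_ge0.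
move=> y z yx; have h1 := H y z yx; have := H y (- z) yx.
rewrite enormN -mulrA [in X in _ -> _ <= X]mulrDl mul1r => h2.
apply: le_trans (lerD h1 h2); apply: le_trans (ler_normD _ _).
rewrite le_eqVlt; apply/orP; left; apply/eqP; congr `|_|.
rewrite /truncated_dotr enormN.
by case: ifP => _; rewrite ?dotrNr; ring.
Qed.

Lemma levy_integrable_second_difference (D : set (borelR R N)) : measurable D ->
  levy_integrable s D (fun z : borelR R N =>
    glued (x + (z : 'rV[R]_N)) + glued (x - (z : 'rV[R]_N)) - 2 * glued x).
Proof.
move=> mD; have [C [rho [C1 rho0 H]]] := glued_second_difference.
apply: (levy_integrable_bounded s12 C0 mD (C := C)).
  apply: measurable_funB => //; apply: measurable_funD.
    by apply: measurable_addl; exact: measurable_glued.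
  by apply: measurable_subl; exact: measurable_glued.
move=> z _; have := H x z; rewrite subrr enorm0 => /(_ rho0).
rewrite -(glued_in (y := x)); last by rewrite /ecball/= subrr enorm0 ltW.
by congr (`|_| <= _); ring.
Qed.

End TestFunction.

End TugOfWar.

(** * The limit of the second differences *)

Lemma near_addn (P : nat -> Prop) k0 :
  (\forall k \near \oo, P k) -> \forall n \near \oo, P (n + k0)%N.
Proof.
by move=> [j _ jP]; exists j => // n /= jn; apply: jP; apply: leq_trans jn (leq_addr _ _).
Qed.

Section Limit.
Context {R : realType} {N : nat} (s alpha : R).
Hypothesis s12 : 2^-1 < s < 1.
Hypothesis C0 : 0 < @CNs R N s.
Hypothesis alpha_bnd : 0 < alpha <= pi / 2.

Notation lam := (lebesgue_rV R N).
Notation dens := (@mu_density R N s).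
Notation T a y := (cone alpha a%:E +oo%E y : set (borelR R N)).

Variables (phi u : 'rV[R]_N -> R) (x : 'rV[R]_N) (r B : R).
Hypotheses (r0 : 0 < r) (phiC2 : is_C2 phi) (cu : continuous u).
Hypothesis uB : forall y, `|u y| <= B.
Hypothesis N_gt0 : (0 < N)%N.
Hypothesis grad0 : grad phi x != 0.

Notation phit := (glued phi u x r).
Notation Lambda := (@levy_mass R N s).
Let p := grad phi x.
Let e := (enorm p)^-1 *: p.

Let p0 : 0 < enorm p. Proof. by rewrite enorm_gt0. Qed.

Let e1 : enorm e = 1.
Proof. by rewrite enormZ gtr0_norm ?invr_gt0// mulVf// gt_eqF. Qed.

Let mphit := measurable_glued x r phiC2 cu.

Let increment y : borelR R N -> R := fun z => phit (y + (z : 'rV[R]_N)) - phi y.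

Let measurable_increment y : measurable_fun [set: borelR R N] (increment y).
Proof. by apply: measurable_funB => //; exact: measurable_addl. Qed.

Let levy_integrable_increment a y v : 0 < a -> enorm v = 1 ->
  levy_integrable s (T a v) (increment y).
Proof.
move=> a0 v1; have [K gK] := glued_bounded x r0 phiC2 uB.
apply: (levy_integrable_cone s12 C0 alpha_bnd (M := K + `|phi y|)) => //.
by move=> z; rewrite (le_trans (ler_normB _ _))// lerD2r.
Qed.

(** The cone average sees the gradient through the diverging first moment,
    and everything else only through the finite Levy mass. *)
Let increment_moment : exists C rho : R, [/\ 0 <= C, 0 < rho &
  forall a y v, 0 < a -> enorm (y - x) < rho -> enorm v = 1 ->
   `|mu_int s (T a v) (increment y) -
     dotr (grad phi y) v * mu_int s (T a e) (truncated_dotr rho e)| <= C].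
Proof.
have [C [rho [C1 rho0 H]]] := glued_expansion x r0 phiC2 uB.
exists (C * Lambda), rho; split => //; first by rewrite mulr_ge0// levy_mass_ge0.
move=> a y v a0 yx v1.
have mT : measurable (T a v) by apply: measurable_cone => //; exact: ltW.
pose t := truncated_dotr rho (grad phi y) : borelR R N -> R.
have mt : measurable_fun [set: borelR R N] t by exact: measurable_truncated_dotr.
have it : levy_integrable s (T a v) t.
  apply: (levy_integrable_cone s12 C0 alpha_bnd (M := enorm (grad phi y) * rho)) => //.
  by move=> z; apply: normr_truncated_dotr_le; exact: ltW.
have md : measurable_fun [set: borelR R N] (fun z => increment y z - t z).
  exact: measurable_funB.
have id : levy_integrable s (T a v) (fun z => increment y z - t z).
  by apply: (levy_integrable_bounded s12 C0 mT md (C := C)) => z _; exact: H.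
have -> : mu_int s (T a v) (increment y) =
    mu_int s (T a v) (fun z => increment y z - t z) + mu_int s (T a v) t.
  by rewrite -(mu_intD mT id it); apply: eq_mu_int => z _; rewrite subrK.
rewrite /t (mu_int_truncated_dotr s12 C0 alpha_bnd _ a0 (ltW rho0) v1).
rewrite (mu_int_truncated_dotr_axis s alpha_bnd rho a0 e1 v1) addrK.
by apply: (normr_mu_int_le s12 C0 C1 mT md) => z _; exact: H.
Qed.

Variables (a_ : nat -> R) (x_ y_ : nat -> 'rV[R]_N).
Hypothesis a0 : forall k, 0 < a_ k.
Hypothesis a_cvg : forall d, 0 < d -> \forall k \near \oo, a_ k < d.
Hypothesis x_cvg : forall d, 0 < d -> \forall k \near \oo, enorm (x_ k - x) < d.
Hypothesis y1 : forall k, enorm (y_ k) = 1.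
Hypothesis near_sup : forall d, 0 < d -> \forall k \near \oo, forall v, enorm v = 1 ->
  - d <= mu_int s (T (a_ k) (y_ k)) (increment (x_ k)) +
         mu_int s (T (a_ k) v) (increment (x_ k)).

(** Take v = - e in the near-optimality condition: up to a bounded error the
    right-hand side is the diverging first moment times the inner product of
    grad phi (x_ k) with y_ k - e, so that this product cannot stay away from
    0 on the negative side; as |y_ k| = |e| = 1, its limit controls
    |y_ k - e|^2. *)
Lemma direction_cvg d : 0 < d -> \forall k \near \oo, enorm (y_ k - e) < d.
Proof.
move=> d0; have [C [rho [C1 rho0 H]]] := increment_moment.
pose b := enorm p * d ^+ 2 / 8.
have b0 : 0 < b by rewrite divr_gt0// mulr_gt0// exprn_gt0.
have [d1 d10 mom] := moment_diverges s12 C0 alpha_bnd ((2 * C + 1) / b) rho0 e1.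
have b20 : 0 < b / 2 by rewrite divr_gt0.
have [d2 d20 gradx] := continuous_grad x (proj1 phiC2) b20.
have n1 : \forall k \near \oo, a_ k < d1 by exact: a_cvg.
have n2 : \forall k \near \oo, enorm (x_ k - x) < Num.min rho d2.
  by apply: x_cvg; rewrite lt_min rho0.
have n3 := near_sup ltr01.
apply: filterS (filterI n1 (filterI n2 n3)) => k [ak [+ sk]].
rewrite lt_min => /andP[xk1 xk2].
have e1' : enorm (- e) = 1 by rewrite enormN.
have := sk _ e1'; have := H _ _ _ (a0 k) xk1 (y1 k); have := H _ _ _ (a0 k) xk1 e1'.
set m := mu_int s _ (truncated_dotr _ _); set Ke := mu_int s _ _; set Ky := mu_int s _ _.
have mb : (2 * C + 1) / b <= m by apply: mom; rewrite a0.
set q := grad phi (x_ k); rewrite dotrNr => hE hY hs.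
have m0 : 0 < m by apply: lt_le_trans mb; rewrite divr_gt0// ltr_wpDl// mulr_ge0.
have qm : (dotr q e - dotr q (y_ k)) * m <= 2 * C + 1.
  move: hE hY; rewrite !ler_norml => /andP[_ h1] /andP[_ h2].
  have -> : (dotr q e - dotr q (y_ k)) * m =
    - (- dotr q e * m + - - dotr q (y_ k) * m) by ring.
  rewrite mulNr in h1 *; rewrite opprK; lra.
have qb : dotr q e - dotr q (y_ k) <= b.
  rewrite -(ler_pM2r m0); apply: le_trans qm _.
  by rewrite [leRHS]mulrC -ler_pdivrMr.
have qp : `|dotr (p - q) (e - y_ k)| <= b.
  apply: le_trans (normr_dotr_le _ _) _.
  have -> : b = b / 2 * 2 by rewrite divfK.
  apply: ler_pM; rewrite ?enorm_ge0//.
    by rewrite enormBC ltW// gradx.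
  by rewrite (le_trans (ler_enormD _ _))// enormN e1 y1.
have pe : enorm p * enorm (y_ k - e) ^+ 2 = 2 * dotr p (e - y_ k).
  rewrite (sqr_enorm_unitB e1 (y1 k)) mulrCA; congr (_ * _).
  by rewrite dotrZl mulrA divff ?mul1r// gt_eqF.
have h : enorm p * enorm (y_ k - e) ^+ 2 <= 4 * b.
  rewrite pe; have : dotr p (e - y_ k) = dotr (p - q) (e - y_ k) + (dotr q e - dotr q (y_ k)).
    by rewrite !dotrE; ring.
  move: qp; rewrite ler_norml => /andP[_ h1] ->; lra.
rewrite -(@ltr_pXn2r _ 2)// ?nnegrE ?enorm_ge0 ?(ltW d0)//.
rewrite -(ltr_pM2l p0); apply: le_lt_trans h _; rewrite /b.
have : 0 < enorm p * d ^+ 2 by rewrite mulr_gt0// exprn_gt0.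
lra.
Qed.

Let second_difference y : borelR R N -> R :=
  fun z => increment y z + increment y (- (z : 'rV[R]_N)).

Let measurable_second_difference y :
  measurable_fun [set: borelR R N] (second_difference y).
Proof.
apply: measurable_funD; first exact: measurable_increment.
exact: (measurableT_comp (measurable_increment y) (@measurable_opprV R N)).
Qed.

Let mu_int_second_difference a y v : 0 < a -> enorm v = 1 -> 1 + dotr e v != 0 ->
  mu_int s (T a v) (increment y) + mu_int s (T a (- v)) (increment y) =
  mu_int s (T a e) (fun z => second_difference y (rotation e v (z : 'rV[R]_N))).
Proof.
move=> a_gt0 v1 ev; have mT : measurable (T a v) by apply: measurable_cone => //; exact: ltW.
rewrite -(mu_int_cone_rotation s alpha_bnd (ltW a_gt0) e1 v1 ev) //.
rewrite (mu_int_coneN s alpha_bnd (ltW a_gt0) v1)// -mu_intD//.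
  exact: levy_integrable_increment.
have [K gK] := glued_bounded x r0 phiC2 uB.
apply: (levy_integrable_cone s12 C0 alpha_bnd (M := K + `|phi y|)) => //.
  exact: (measurableT_comp (measurable_increment y) (@measurable_opprV R N)).
by move=> z; rewrite (le_trans (ler_normB _ _))// lerD2r.
Qed.

Let glued_cvg (w_ : nat -> 'rV[R]_N) w : enorm (w - x) != r ->
  (forall d, 0 < d -> \forall k \near \oo, enorm (w_ k - w) < d) ->
  (fun k => phit (w_ k)) @ \oo --> phit w.
Proof.
move=> wr w_cvg; apply/cvgrPdist_lt => d d0.
have cw : {for w, continuous phit} by exact: glued_continuous.
have [d' d'0 H] := (continuous_enormP phit w).1 cw d d0.
by apply: filterS (w_cvg _ d'0) => k /H; rewrite distrC.
Qed.

Let phi_cvg : (fun k => phi (x_ k)) @ \oo --> phi x.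
Proof.
apply/cvgrPdist_lt => d d0.
have cx : {for x, continuous phi} by exact: (C1_continuous (proj1 phiC2)).
have [d' d'0 H] := (continuous_enormP phi x).1 cx d d0.
by apply: filterS (x_cvg d'0) => k /H; rewrite distrC.
Qed.

Let rotation_cvg z d : 0 < d ->
  \forall k \near \oo, enorm (rotation e (y_ k) z - z) < d.
Proof.
move=> d0; have c0 : 0 < 6 * enorm z + 1 by rewrite ltr_wpDl// mulr_ge0// enorm_ge0.
have n1 := direction_cvg (divr_gt0 d0 c0); have n2 := direction_cvg ltr01.
apply: filterS (filterI n1 n2) => k [h1 h2].
have ey : 0 <= dotr e (y_ k).
  have : enorm (y_ k - e) ^+ 2 <= 1 by rewrite exprn_ile1 ?enorm_ge0// ltW.
  by rewrite (sqr_enorm_unitB e1 (y1 k)) dotrDr dotrNr dotr_unit//; lra.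
apply: le_lt_trans (enorm_rotation_sub z e1 (y1 k) ey) _.
rewrite ltr_pdivlMr// in h1; apply: le_lt_trans h1.
by rewrite mulrA mulrC ler_wpM2l ?enorm_ge0// lerDl.
Qed.

(** Take v = - y_ k in the near-optimality condition: the sum is an integral of
    second differences over a cone of axis y_ k, and a rotation carries it to
    the cone of axis e. There the integrands are dominated by the Levy weight
    and converge off the sphere |z| = r, where the glued function may jump. *)
Lemma mu_int_second_difference_ge0 :
  0 <= mu_int s (T 0 e) (fun z => phit (x + z) + phit (x - z) - 2 * phit x).
Proof.
have [C [rho [C1 rho0 H]]] := glued_second_difference x r0 phiC2 uB.
(* dominated convergence wants a bound for all indices: drop the first ones *)
have [k0 _ hk0] : \forall k \near \oo, enorm (x_ k - x) < rho /\ enorm (y_ k - e) < 1.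
  by apply: filterI; [exact: x_cvg|exact: direction_cvg].
pose X n := x_ (n + k0)%N; pose Y n := y_ (n + k0)%N; pose A n := a_ (n + k0)%N.
have kP n : enorm (X n - x) < rho /\ enorm (Y n - e) < 1 by apply: hk0; exact: leq_addl.
have Y1 n : enorm (Y n) = 1 by exact: y1.
have A0 n : 0 < A n by exact: a0.
have eY n : 1 + dotr e (Y n) != 0.
  have : enorm (Y n - e) ^+ 2 <= 1 by rewrite exprn_ile1 ?enorm_ge0// ltW// (kP n).2.
  rewrite (sqr_enorm_unitB e1 (Y1 n)) dotrDr dotrNr dotr_unit// => h.
  by rewrite gt_eqF//; lra.
have mT0 : measurable (T 0 e) by exact: measurable_cone.
have mTA n : measurable (T (A n) e) by apply: measurable_cone => //; exact: ltW.
have mrot n : measurable_fun [set: borelR R N]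
    (rotation e (Y n) : borelR R N -> borelR R N).
  by apply: measurable_isometry => [|z]; [exact: rotationD|exact: enorm_rotation].
pose D n : borelR R N -> R :=
  fun z => second_difference (X n) (rotation e (Y n) (z : 'rV[R]_N)).
have mD n : measurable_fun [set: borelR R N] (D n).
  exact: (measurableT_comp (measurable_second_difference (X n)) (mrot n)).
pose f_ n : borelR R N -> \bar R := fun z => (\1_(T (A n) e) z * (D n z * dens z))%:E.
pose fl : borelR R N -> R := fun z =>
  phit (x + (z : 'rV[R]_N)) + phit (x - (z : 'rV[R]_N)) - 2 * phit x.
pose f : borelR R N -> \bar R := fun z => (fl z * dens z)%:E.
pose g : borelR R N -> \bar R := fun z => (C * @levy_weight R N s z)%:E.
have mdens := @measurable_density R N s.
have mf_ n : measurable_fun (T 0 e) (f_ n).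
  apply/measurable_EFinP; apply: measurable_funTS; apply: measurable_funM.
    exact: measurable_indic.
  exact: measurable_funM.
have mfl : measurable_fun [set: borelR R N] fl.
  apply: measurable_funB => //; apply: measurable_funD.
    exact: measurable_addl.
  exact: measurable_subl.
have mf : measurable_fun (T 0 e) f.
  by apply/measurable_EFinP; apply: measurable_funTS; exact: measurable_funM.
have ig : lam.-integrable (T 0 e) g.
  have iW : lam.-integrable (T 0 e) (EFin \o @levy_weight R N s).
    by apply: integrableS (integrable_levy_weight s12 C0).
  exact: (integrableZl mT0 C iW).
have f_g : {ae lam, forall z n, T 0 e z -> (`|f_ n z| <= g z)%E}.
  apply: aeW => z n _; rewrite /f_ /g lee_fin normrM.
  rewrite (_ : `|D n z * dens z| = `|D n z| * dens z); last first.
    by rewrite normrM (ger0_norm (density_ge0 C0 z)).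
  rewrite /levy_weight [leRHS]mulrA -[leRHS]mul1r; apply: ler_pM => //.
  - by rewrite mulr_ge0// density_ge0.
  - by rewrite indicE; case: (_ \in _); rewrite ?normr1 ?normr0.
  - rewrite ler_wpM2r ?density_ge0//.
    by have := H (X n) (rotation e (Y n) z) (kP n).1; rewrite enorm_rotation.
have f_f : {ae lam, forall z, T 0 e z -> f_ ^~ z @ \oo --> f z}.
  (* the exceptional set, where x + z or x - z lies on the boundary of the ball *)
  exists [set z : borelR R N | enorm (z : 'rV[R]_N) = r]; split.
  - exact: (measurable_enorm_set (measurable_set1 r)).
  - exact: lebesgue_rV_sphere.
  - move=> z /= hz; apply: contrapT => zr; apply: hz => T0z.
    have zr' : enorm (z : 'rV[R]_N) != r by apply/eqP.
    have T0z' := (coneP alpha_bnd z (lexx 0) e1).1 T0z.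
    apply: cvg_EFin; first by near=> n.
    rewrite /f_ /f (_ : fine \o _ = (fun n => \1_(T (A n) e) z * (D n z * dens z)))//=.
    rewrite -[fl z * _]mul1r; apply: cvgM.
      apply: cvg_near_cst; have z0 : 0 < enorm (z : 'rV[R]_N) by case: T0z'.
      apply: filterS (near_addn k0 (a_cvg z0)) => n an; rewrite indicE mem_set//.
      by apply/(coneP alpha_bnd _ (ltW (A0 n)) e1); split => //; case: T0z'.
    apply: cvgM; last exact: cvg_cst.
    have xz : enorm (x + z - x) != r by rewrite addrAC subrr add0r.
    have xz' : enorm (x - z - x) != r by rewrite addrAC subrr add0r enormN.
    have Xz d : 0 < d -> \forall n \near \oo,
        enorm (X n - x) < d / 2 /\ enorm (rotation e (Y n) z - z) < d / 2.
      move=> d0; have d20 : 0 < d / 2 by rewrite divr_gt0.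
      exact: (near_addn k0 (filterI (x_cvg d20) (rotation_cvg z d20))).
    rewrite (_ : fl z = (phit (x + z) - phi x) + (phit (x - z) - phi x)); last first.
      rewrite /fl (glued_in _ _ (y := x)); first by ring.
      by rewrite /ecball/= subrr enorm0 ltW.
    have phiX : (fun n => phi (X n)) @ \oo --> phi x.
      by have := phi_cvg; rewrite -(cvg_shiftn k0).
    apply: cvgD; apply: cvgB => //; apply: glued_cvg => // d d0;
      apply: filterS (Xz d d0) => n [h1 h2].
      have -> : X n + rotation e (Y n) z - (x + z) = (X n - x) + (rotation e (Y n) z - z).
        by rewrite opprD addrACA.
      by apply: le_lt_trans (ler_enormD _ _) _; rewrite [ltRHS]splitr ltrD.
    have -> : X n - rotation e (Y n) z - (x - z) = (X n - x) - (rotation e (Y n) z - z).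
      by rewrite !opprD !opprK addrACA.
    by apply: le_lt_trans (ler_enormD _ _) _; rewrite enormN [ltRHS]splitr ltrD.
have [fi _ fcvg] := dominated_convergence mT0 mf_ mf f_f ig f_g.
have ffin := integrable_fin_num mT0 fi.
suff : (0 <= \int[lam]_(z in T 0 e) f z)%E.
  by move=> h; apply: fine_ge0.
rewrite -(fineK ffin) lee_fin; apply/ler_addgt0Pr => d d0.
rewrite -lerBlDr sub0r -lee_fin (fineK ffin).
apply: (cvge_to_ge fcvg); apply: filterS (near_addn k0 (near_sup d0)) => n /(_ (- Y n)).
rewrite enormN Y1 => /(_ erefl).
rewrite (mu_int_second_difference (X n) (A0 n) (Y1 n) (eY n)) => h.
have mAe : measurable_fun (T (A n) e) (EFin \o (fun z => D n z * dens z)).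
  by apply/measurable_EFinP; apply: measurable_funTS; exact: measurable_funM.
have E : (\int[lam]_(z in T 0 e) f_ n z = \int[lam]_(z in T (A n) e) (D n z * dens z)%:E)%E.
  have -> : T (A n) e = T 0 e `&` T (A n) e.
    apply/esym/setIidPr => z /(coneP alpha_bnd _ (ltW (A0 n)) e1)[h1 h2].
    by apply/(coneP alpha_bnd _ (lexx 0) e1); split => //; exact: lt_trans h2.
  rewrite [RHS]integral_mkcondr; apply: eq_integral => z zT.
  rewrite patchE /f_ indicE; case: ifP => _; first by rewrite mul1r.
  by rewrite mul0r.
suff : ((- d)%:E <= \int[lam]_(z in T 0 e) f_ n z)%E by [].
rewrite E -(fineK (x := \int[lam]_(z in T (A n) e) (D n z * dens z)%:E)%E) ?lee_fin//.
apply: (integrable_fin_num (mTA n)).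
apply: (levy_integrable_bounded s12 C0 (mTA n) (mD n) (C := C)) => z _.
by have := H (X n) (rotation e (Y n) z) (kP n).1; rewrite enorm_rotation.
Unshelve. all: by end_near.
Qed.

End Limit.

(** * Contact from above *)

Section Viscosity.
Context {R : realType} {N : nat} (s alpha : R).
Hypothesis s12 : 2^-1 < s < 1.
Hypothesis C0 : 0 < @CNs R N s.
Hypothesis alpha_bnd : 0 < alpha <= pi / 2.
Hypothesis N_gt0 : (0 < N)%N.

Notation T a y := (cone alpha a%:E +oo%E y : set (borelR R N)).
Notation Lambda := (@levy_mass R N s).

Lemma exists_near_max (A : set 'rV[R]_N) (f : 'rV[R]_N -> R) (M eta : R) :
  A !=set0 -> (forall y, A y -> f y <= M) -> 0 < eta ->
  exists2 y, A y & forall z, A z -> f z <= f y + eta.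
Proof.
move=> [y0 Ay0] fM eta0; have hs : has_sup (f @` A).
  split; first by exists (f y0), y0.
  by exists M => _ [y Ay <-]; exact: fM.
have [_ [y Ay <-] h] := sup_adherent eta0 hs; exists y => // z Az.
rewrite -lerBlDr; apply/ltW; apply: le_lt_trans h; rewrite lerD2r.
by apply: (ub_le_sup hs.2); exists z.
Qed.

Lemma mu_int_far_le (a rho : R) v : 0 < a -> 0 < rho -> enorm v = 1 ->
  mu_int s (T a v) (\1_[set z : borelR R N | rho <= enorm (z : 'rV[R]_N)]) <=
  Lambda / Num.min (rho ^+ 2) 1.
Proof.
move=> a0 rho0 v1; set m := Num.min _ _.
have m0 : 0 < m by rewrite lt_min exprn_gt0/=.
have mF := @measurable_enorm_ge R N rho.
apply: le_trans (ler_norm _) _; rewrite mulrC.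
apply: (normr_mu_int_le s12 C0) => //.
- by rewrite invr_ge0 ltW.
- by apply: measurable_cone => //; exact: ltW.
- move=> z _; rewrite indicE; case: (boolP (_ \in _)) => [/set_mem/= zr|_].
    rewrite normr1 mulrC ler_pdivlMr// mul1r le_min !ge_min lexx orbT andbT.
    by apply/orP; left; rewrite ler_pXn2r ?nnegrE ?enorm_ge0// ltW.
  by rewrite normr0 mulr_ge0 ?invr_ge0 ?(ltW m0)// le_min sqr_ge0 ler01.
Qed.

(** A uniform error eta costs eta times the mass of the truncated cone, which
    blows up with the truncation; an error supported away from the origin
    costs a bounded amount. *)
Lemma mu_int_le_perturbed (a rho eta gamma B m : R) (f g : borelR R N -> R) v :
  0 < a -> 0 < rho -> 0 <= gamma -> enorm v = 1 ->
  measurable_fun [set: borelR R N] f -> measurable_fun [set: borelR R N] g ->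
  (forall z, `|f z| <= B) -> (forall z, `|g z| <= B) ->
  (forall z, f z <= g z +
    (eta + gamma * \1_[set z : borelR R N | rho <= enorm (z : 'rV[R]_N)] z)) ->
  mu_int s (T a v) (cst 1) = m ->
  mu_int s (T a v) f <= mu_int s (T a v) g +
    (eta * m + gamma * (Lambda / Num.min (rho ^+ 2) 1)).
Proof.
move=> a0 rho0 gamma0 v1 mf mg fB gB fg massE.
have mF := @measurable_enorm_ge R N rho.
set F := [set z | _] in fg mF *.
have mT : measurable (T a v) by apply: measurable_cone => //; exact: ltW.
have int (h : borelR R N -> R) (M : R) : measurable_fun [set: borelR R N] h ->
    (forall z, `|h z| <= M) -> levy_integrable s (T a v) h.
  by move=> mh hM; exact: (levy_integrable_cone s12 C0 alpha_bnd a0 v1 mh hM).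
have i1 : levy_integrable s (T a v) (cst 1) by apply: (int _ 1) => // z; rewrite normr1.
have iF : levy_integrable s (T a v) (\1_F).
  apply: (int (\1_F) 1); first by [].
  by move=> z; rewrite indicE; case: (_ \in _); rewrite ?normr1 ?normr0.
have i2 : levy_integrable s (T a v) (fun z => eta * cst 1 z) by exact: levy_integrableZ.
have i3 : levy_integrable s (T a v) (fun z => gamma * \1_F z) by exact: levy_integrableZ.
have i4 := levy_integrableD mT i2 i3.
have ig := int g B mg gB.
apply: (@le_trans _ _ (mu_int s (T a v)
    (fun z => g z + (eta * cst 1 z + gamma * \1_F z)))).
  apply: (le_mu_int C0 mT (int f B mf fB) (levy_integrableD mT ig i4)) => z _.
  by rewrite mulr1; exact: fg.
rewrite (mu_intD mT ig i4) (mu_intD mT i2 i3) (mu_intZ _ mT i1) (mu_intZ _ mT iF) massE.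
by rewrite lerD2l lerD2l ler_wpM2l// mu_int_far_le.
Qed.

(** A strict contact point is the limit of near-maximum points of
    uniformly close functions: off any neighbourhood of x the gap phi - u has
    a positive minimum on the compact ball. *)
Lemma near_max_cvg (phi u : 'rV[R]_N -> R) (f_ : nat -> 'rV[R]_N -> R)
    (x : 'rV[R]_N) (r : R) (eta : nat -> R) (x_ : nat -> 'rV[R]_N) :
  continuous phi -> continuous u -> 0 < r -> phi x = u x ->
  (forall y, ecball x r y -> y != x -> u y < phi y) ->
  (forall d, 0 < d -> \forall k \near \oo, forall y, `|f_ k y - u y| < d) ->
  (forall d, 0 < d -> \forall k \near \oo, eta k < d) ->
  (forall k, ecball x r (x_ k)) ->
  (forall k y, ecball x r y -> f_ k y - phi y <= f_ k (x_ k) - phi (x_ k) + eta k) ->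
  forall d, 0 < d -> \forall k \near \oo, enorm (x_ k - x) < d.
Proof.
move=> cphi cu r0 xE contact unif eta_cvg xball xmax d d0.
pose A : set 'rV[R]_N := ecball x r `&` [set y | d <= enorm (y - x)].
have cA : compact A.
  apply: compact_closedI; first exact: compact_ecball.
  rewrite (_ : [set y | _] = (fun y => enorm (y - x)) @^-1` [set t | d <= t])//.
  apply: closed_comp => [y _|]; last exact: closed_ge.
  apply/continuous_enormP => b b0; exists b => // z zy.
  by apply: le_lt_trans (ler_dist_enorm _ _) _; rewrite opprB addrA subrK.
have xx : ecball x r x by rewrite /ecball/= subrr enorm0 ltW.
have [m m0 gap] : exists2 m : R, 0 < m & forall y, A y -> m <= phi y - u y.
  have [A0|/set0P A0] := eqVneq A set0.
    by exists 1 => // y; rewrite A0.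
  have cg : {within A, continuous (fun y => phi y - u y)}.
    by apply: continuous_subspaceT => y; apply: continuousB; [exact: cphi|exact: cu].
  have [c /set_mem[cr cd] cmin] := EVT_min_rV A0 cA cg.
  exists (phi c - u c); last by move=> y Ay; apply: cmin; exact/mem_set.
  rewrite subr_gt0; apply: contact => //; apply/eqP => cx; move: cd.
  by rewrite cx/= subrr enorm0 leNgt d0.
have m30 : 0 < m / 3 by rewrite divr_gt0.
apply: filterS (filterI (unif _ m30) (eta_cvg _ m30)) => k [h1 h2].
rewrite ltNge; apply/negP => dk.
have := gap _ (conj (xball k) dk); have := xmax k _ xx.
have := h1 x; have := h1 (x_ k); rewrite !ltr_norml => /andP[a1 a2] /andP[a3 a4].
rewrite xE => a5; lra.
Qed.

(** At near-maximum points x_ k of f_ k - phi on the ball, the increments of f_ k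
    are at most those of the glued function, up to eta k everywhere and up to
    a constant tending to 0 outside the ball. So the near-optimality of y_ k
    for f_ k passes to the glued function with an error tending to 0, and the
    limit of second differences applies. *)
Lemma touching_above (D : set 'rV[R]_N) (eps : nat -> R)
    (f_ : nat -> 'rV[R]_N -> R) (u phi : 'rV[R]_N -> R) (x : 'rV[R]_N) (r : R) :
  open D -> (forall k, 0 < eps k) -> (forall d, 0 < d -> \forall k \near \oo, eps k < d) ->
  (forall k, measurable_fun [set: borelR R N] (f_ k : borelR R N -> R)) ->
  (forall k, exists B, forall y, `|f_ k y| <= B) ->
  (forall k y, D y -> f_ k y = avg_op s alpha (eps k) (f_ k) y) ->
  (forall d, 0 < d -> \forall k \near \oo, forall y, `|f_ k y - u y| < d) ->
  continuous u -> D x -> 0 < r -> is_C2 phi -> phi x = u x -> grad phi x != 0 ->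
  (forall y, ecball x r y -> y != x -> u y < phi y) ->
  0 <= mu_int s (T 0 ((enorm (grad phi x))^-1 *: grad phi x))
    (fun z => glued phi u x r (x + z) + glued phi u x r (x - z) - 2 * glued phi u x r x).
Proof.
move=> oD eps0 eps_cvg mf fB dpp unif cu Dx r0 phiC2 xE grad0 contact.
have cphi := C1_continuous (proj1 phiC2).
have [B uB] : exists B, forall y, `|u y| <= B.
  have [k _ /(_ k (leqnn k)) hk] := unif 1 ltr01.
  have [B hB] := fB k; exists (B + 1) => y.
  have := hB y; have := hk y; rewrite ltr_norml ler_norml => /andP[h1 h2] /andP[h3 h4].
  by rewrite ler_norml; apply/andP; split; lra.
have [K gK] := glued_bounded x r0 phiC2 uB.
pose e := (enorm (grad phi x))^-1 *: grad phi x.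
have e1 : enorm e = 1.
  by rewrite enormZ ger0_norm ?invr_ge0 ?enorm_ge0// mulVf// enorm_eq0.
pose m k := mu_int s (T (eps k) e) (cst 1).
have m0 k : 0 < m k by exact: cone_mass_gt0.
(* the tolerance must beat the mass of the cone, hence the division *)
pose eta k := eps k / (m k + 1).
have m1 k : 0 < m k + 1 by rewrite addr_gt0.
have eta0 k : 0 < eta k by rewrite divr_gt0.
have eta_eps k : eta k <= eps k.
  by rewrite ler_pdivrMr// ler_peMr ?(ltW (eps0 k))// lerDr ltW.
have etam k : eta k * m k <= eps k.
  by rewrite /eta mulrAC ler_pdivrMr// ler_wpM2l ?(ltW (eps0 k))// lerDl.
have xx : ecball x r x by rewrite /ecball/= subrr enorm0 ltW.
have Hx k : exists2 y, ecball x r y & forall z, ecball x r z ->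
    f_ k z - phi z <= f_ k y - phi y + eta k.
  have [Bk hBk] := fB k.
  apply: (@exists_near_max _ (fun y => f_ k y - phi y) (Bk + K)) => //.
    by exists x.
  move=> y xy; apply: lerD; first exact: le_trans (ler_norm _) (hBk y).
  by rewrite -(glued_in phi u xy); apply: le_trans (ler_norm _) _; rewrite normrN.
pose x_ k := sval (cid2 (Hx k)).
have xball k : ecball x r (x_ k) by rewrite /x_; case: cid2.
have xmax k y : ecball x r y -> f_ k y - phi y <= f_ k (x_ k) - phi (x_ k) + eta k.
  by rewrite /x_; case: cid2 => z /= _; exact.
have x_cvg : forall d, 0 < d -> \forall k \near \oo, enorm (x_ k - x) < d.
  apply: (near_max_cvg cphi cu r0 xE contact unif _ xball xmax) => d d0.
  by apply: filterS (eps_cvg d d0) => k; exact: le_lt_trans.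
have Hy k : exists y, enorm y = 1 /\ (D (x_ k) -> forall v, enorm v = 1 ->
    - eps k <= mu_int s (T (eps k) y) (fun z => f_ k (x_ k + z) - f_ k (x_ k))
             + mu_int s (T (eps k) v) (fun z => f_ k (x_ k + z) - f_ k (x_ k))).
  have [Dk|Dk] := pselect (D (x_ k)); last by exists e.
  have [Bk hBk] := fB k.
  have [y y1 hy] := avg_op_near_sup s12 C0 alpha_bnd (eps0 k) (eps0 k) e1 (mf k) hBk
    (dpp k _ Dk).
  by exists y.
pose y_ k := sval (cid (Hy k)).
have y1 k : enorm (y_ k) = 1 by rewrite /y_; case: cid => y [].
apply: (@mu_int_second_difference_ge0 R N s alpha s12 C0 alpha_bnd phi u x r B r0
  phiC2 cu uB N_gt0 grad0 eps x_ y_ eps0 eps_cvg x_cvg y1) => d d0.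
pose L := Lambda / Num.min ((r / 2) ^+ 2) 1.
have r20 : 0 < r / 2 by rewrite divr_gt0.
have L0 : 0 <= L by rewrite divr_ge0 ?levy_mass_ge0// le_min sqr_ge0 ler01.
pose c := d / (8 * (L + 1)).
have L1 : 0 < 8 * (L + 1) by rewrite mulr_gt0// ltr_wpDl.
have c0 : 0 < c by rewrite divr_gt0.
have cL : c * L <= d / 8.
  rewrite /c mulrAC ler_pdivrMr//.
  have -> : d / 8 * (8 * (L + 1)) = d * (L + 1) by field.
  rewrite ler_wpM2l ?(ltW d0)//.
  by rewrite lerDl.
have c40 : 0 < c / 4 by rewrite divr_gt0.
have c20 : 0 < c / 2 by rewrite divr_gt0.
have d60 : 0 < d / 6 by rewrite divr_gt0.
have cg : {for x, continuous (fun y => phi y - u y)}.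
  by apply: continuousB; [exact: cphi|exact: cu].
have [d1 d10 Hd1] := (continuous_enormP _ x).1 cg _ c20.
have /nbhs_enormP[d2 d20 Hd2] : nbhs x D by exact: open_nbhs_nbhs.
have dm : 0 < Num.min (Num.min d1 d2) (r / 2) by rewrite !lt_min d10 d20.
apply: filterS (filterI (x_cvg _ dm) (filterI (unif _ c40) (eps_cvg _ d60))).
move=> k [+ [fk ek]] v v1; rewrite !lt_min => /andP[/andP[xk1 xk2] xk3].
have Dk : D (x_ k) by exact: Hd2.
have := (svalP (cid (Hy k))).2 Dk v v1; rewrite -/(y_ k).
have gapx : `|phi (x_ k) - u (x_ k)| < c / 2 by have := Hd1 _ xk1; rewrite xE subrr subr0.
have pw z : f_ k (x_ k + z) - f_ k (x_ k) <= glued phi u x r (x_ k + z) - phi (x_ k) +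
    (eta k + c * \1_[set z : borelR R N | r / 2 <= enorm (z : 'rV[R]_N)] z).
  have [xz|xz] := pselect (ecball x r (x_ k + z)).
    rewrite (glued_in phi u xz); have := xmax k _ xz.
    have : 0 <= c * \1_[set z : borelR R N | r / 2 <= enorm (z : 'rV[R]_N)] z.
      by rewrite mulr_ge0// ltW.
    lra.
  rewrite glued_out// indicE mem_set; last first.
    rewrite /= leNgt; apply/negP => zr; apply: xz; rewrite /ecball/= addrAC.
    apply: le_trans (ler_enormD _ _) _; rewrite [leRHS]splitr.
    by rewrite lerD// ltW.
  rewrite mulr1; move: gapx (fk (x_ k)) (fk (x_ k + z)) (eta0 k).
  rewrite !ltr_norml => /andP[g1 g2] /andP[g3 g4] /andP[g5 g6] g7; lra.
have [Bk hBk] := fB k.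
have B1 z : `|f_ k (x_ k + z) - f_ k (x_ k)| <= Num.max (2 * Bk) (K + `|phi (x_ k)|).
  rewrite le_max; apply/orP; left; apply: le_trans (ler_normB _ _) _.
  by rewrite mulrDl mul1r lerD.
have B2 z : `|glued phi u x r (x_ k + z) - phi (x_ k)| <= Num.max (2 * Bk) (K + `|phi (x_ k)|).
  rewrite le_max; apply/orP; right; apply: le_trans (ler_normB _ _) _.
  by rewrite lerD2r.
have mf1 : measurable_fun [set: borelR R N]
    (fun z : borelR R N => f_ k (x_ k + (z : 'rV[R]_N)) - f_ k (x_ k)).
  by apply: measurable_funB => //; exact: measurable_addl.
have mg1 : measurable_fun [set: borelR R N]
    (fun z : borelR R N => glued phi u x r (x_ k + (z : 'rV[R]_N)) - phi (x_ k)).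
  by apply: measurable_funB => //; apply: measurable_addl; exact: measurable_glued.
have mass w : enorm w = 1 -> mu_int s (T (eps k) w) (cst 1) = m k.
  by move=> w1; exact: cone_mass_axis.
have ub w : enorm w = 1 -> mu_int s (T (eps k) w) (fun z => f_ k (x_ k + z) - f_ k (x_ k)) <=
    mu_int s (T (eps k) w) (fun z => glued phi u x r (x_ k + z) - phi (x_ k)) +
      (eta k * m k + c * L).
  move=> w1; exact: (mu_int_le_perturbed (eps0 k) r20 (ltW c0) w1 mf1 mg1 B1 B2 pw
    (mass w w1)).
have := ub _ v1; have := ub _ (y1 k); have := etam k.
lra.
Qed.

End Viscosity.

(** * The viscosity inequalities *)

Lemma uniform_cvg_near (R : realType) (T : choiceType) (f_ : nat -> T -> R) (u : T -> R) :
  {uniform, f_ @ \oo --> u} ->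
  forall d, 0 < d -> \forall k \near \oo, forall y, `|f_ k y - u y| < d.
Proof.
move=> fu d d0.
have : nbhs (u : {uniform` [set: T] -> R}) [set g : T -> R | forall y, `|g y - u y| < d].
  apply/uniform_nbhs; exists [set xy | ball xy.1 d xy.2]; split.
    by rewrite -entourage_ballE; exists d.
  by move=> g /= H y; rewrite distrC; exact: H.
by move=> /fu.
Qed.

Lemma bounded_fun_norm (R : realType) (T : Type) (f : T -> R) :
  bounded_fun f -> exists B, forall y, `|f y| <= B.
Proof. by move=> [M [_ HM]]; exists (M + 1) => y; apply: HM => //; rewrite ltrDl. Qed.

Lemma CNs_ge0 (R : realType) (N : nat) (s : R) : 0 <= s -> 0 <= @CNs R N s.
Proof.
move=> s0; have Gamma_ge0 t : 0 <= Gamma t :> R.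
  by apply: Rintegral_ge0 => w _; rewrite mulr_ge0 ?powR_ge0 ?expR_ge0.
by rewrite divr_ge0 ?mulr_ge0 ?powR_ge0.
Qed.

(** When C(N, s) = 0 both inequalities of the theorem are trivial; this case is
    split off instead of showing that the Gamma integrals are positive and
    finite. *)
Lemma mu_int_CNs0 (R : realType) (N : nat) (s : R) (T : set 'rV[R]_N) f :
  @CNs R N s = 0 -> mu_int s T f = 0.
Proof.
move=> C0; rewrite /mu_int /Rintegral integral0_eq// => z _.
by rewrite /mu_density C0 mul0r mulr0.
Qed.

Section Symmetry.
Context {R : realType} {N : nat} (s alpha : R).
Hypothesis s12 : 2^-1 < s < 1.
Hypothesis C0 : 0 < @CNs R N s.
Hypothesis alpha_bnd : 0 < alpha <= pi / 2.

Lemma avg_opN (f : 'rV[R]_N -> R) (a : R) (x : 'rV[R]_N) : 0 < a ->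
  measurable_fun [set: borelR R N] (f : borelR R N -> R) -> bounded_fun f ->
  avg_op s alpha a (fun y => - f y) x = - avg_op s alpha a f x.
Proof.
move=> a0 mf /bounded_fun_norm[B fB]; rewrite /avg_op.
set S := (X in _ = - (_ * (sup X + _))); set S' := (X in sup X + _).
change (2^-1 * (sup S' + inf S') = - (2^-1 * (sup S + inf S))).
have -> : S' = -%R @` S.
  have avgN y : enorm y = 1 ->
      mu_avg s (cone alpha a%:E +oo%E y) (fun z => - f (x + z)) =
      - mu_avg s (cone alpha a%:E +oo%E y) (fun z => f (x + z)).
    move=> y1; have mT := measurable_cone alpha_bnd (ltW a0) y1.
    have fi := levy_integrable_cone s12 C0 alpha_bnd a0 y1 (measurable_addl x mf)
      (fun z : borelR R N => fB (x + (z : 'rV[R]_N))).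
    rewrite /mu_avg -mulrN; congr (_ * _); rewrite -[RHS]mulN1r -(mu_intZ _ mT fi).
    by apply: eq_mu_int => z _; rewrite mulN1r.
  apply/seteqP; split => [_ [y y1 <-]|_ [_ [y y1 <-] <-]].
    by exists (mu_avg s (cone alpha a%:E +oo%E y) (fun z => f (x + z)));
      [exists y|rewrite avgN].
  by exists y => //; rewrite avgN.
have -> : inf (-%R @` S) = - sup S.
  by rewrite /inf setNK.
have -> : sup (-%R @` S) = - inf S by rewrite /inf opprK.
by rewrite -mulrN opprD addrC.
Qed.

(** The second difference is even in z. *)
Lemma mu_int_opp_axis (v : 'rV[R]_N -> R) (x e : 'rV[R]_N) : enorm e = 1 ->
  measurable_fun [set: borelR R N] (v : borelR R N -> R) ->
  mu_int s (cone alpha 0%:E +oo%E (- e)) (fun z => v (x + z) + v (x - z) - 2 * v x) =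
  mu_int s (cone alpha 0%:E +oo%E e) (fun z => v (x + z) + v (x - z) - 2 * v x).
Proof.
move=> e1 mv; rewrite mu_int_coneN//.
  by apply: eq_mu_int => z _; rewrite opprK [v (x - z) + _]addrC.
apply: measurable_funB => //; apply: measurable_funD.
  exact: measurable_addl.
exact: measurable_subl.
Qed.

End Symmetry.

Lemma gluedN (R : realType) (N : nat) (phi u : 'rV[R]_N -> R) x r y :
  glued (fun y => - phi y) (fun y => - u y) x r y = - glued phi u x r y.
Proof. by rewrite /glued !mulrN -opprD. Qed.

Lemma gradN (R : realType) (N : nat) (f : 'rV[R]_N -> R) x : is_C1 f ->
  grad (fun y => - f y) x = - grad f x.
Proof. by move=> C1; apply/rowP => i; rewrite !mxE partialN. Qed.

Lemma grad_glued (R : realType) (N : nat) (phi u : 'rV[R]_N -> R) x r : 0 < r ->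
  grad (glued phi u x r) x = grad phi x.
Proof.
move=> r0; apply: near_eq_grad; apply/nbhs_enormP; exists r => // y yr.
by rewrite glued_in// /ecball/= ltW.
Qed.

Theorem theorem6p1 (R : realType) (N : nat) (p s alpha : R)
  (F : 'rV[R]_N -> R) (D : set 'rV[R]_N)
  (eps : nat -> R) (u_ : R -> 'rV[R]_N -> R) (u : 'rV[R]_N -> R) :
  (2 <= N)%N ->
  2 <= p ->
  2^-1 < s < 1 ->
  is_alpha N p alpha ->
  unif_continuous F ->
  bounded_fun F ->
  open D ->
  bounded_set D ->
  (forall k, 0 < eps k) ->
  eps @ \oo --> 0 ->
  (forall k, bvp_solution s alpha D F (eps k) (u_ (eps k))) ->
  {uniform, (fun k => u_ (eps k)) @ \oo --> u} ->
  continuous u ->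
  forall (x : 'rV[R]_N) (r : R) (phi : 'rV[R]_N -> R),
    D x -> 0 < r -> is_C2 phi -> phi x = u x -> grad phi x != 0 ->
    let phit := fun y =>
      \1_(ecball x r) y * phi y + \1_(~` ecball x r) y * u y in
    ((forall y, ecball x r y -> y != x -> phi y > u y) ->
      0 <= L_op s alpha phit x) /\
    ((forall y, ecball x r y -> y != x -> phi y < u y) ->
      L_op s alpha phit x <= 0).
Proof.
move=> N2 _ s12 [alpha_bnd _] _ _ oD _ eps0 eps_cvg sol unif cu x r phi Dx r0 phiC2 xE grad0 phit.
have N0 : (0 < N)%N by exact: leq_trans N2.
have s0 : 0 <= s by have /andP[+ _] := s12; lra.
have [C0|C0] := eqVneq (@CNs R N s) 0; first by rewrite /L_op mu_int_CNs0.
have {C0 s0} C0 : 0 < @CNs R N s by rewrite lt0r C0 CNs_ge0.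
have {}eps_cvg d : 0 < d -> \forall k \near \oo, eps k < d.
  move=> d0; move/cvgrPdist_lt : eps_cvg => /(_ d d0); apply: filterS => k.
  by rewrite sub0r normrN ger0_norm ?(ltW (eps0 k)).
have {}unif := uniform_cvg_near unif.
have mu_ k : measurable_fun [set: borelR R N] (u_ (eps k) : borelR R N -> R).
  by case: (sol k).
have bu_ k : bounded_fun (u_ (eps k)) by case: (sol k).
have dpp k y : D y -> u_ (eps k) y = avg_op s alpha (eps k) (u_ (eps k)) y.
  by case: (sol k) => _ _ + _; exact.
have gradE : grad phit x = grad phi x by exact: grad_glued.
split=> contact.
  rewrite /L_op gradE.
  apply: (touching_above s12 C0 alpha_bnd N0 oD eps0 eps_cvg mu_ _ dpp unif) => // k.
  exact: bounded_fun_norm.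
(* the second inequality is the first one for - u and - phi *)
have phiNC2 := is_C2N phiC2.
set e := (enorm (grad phi x))^-1 *: grad phi x.
have e1 : enorm e = 1.
  by rewrite enormZ ger0_norm ?invr_ge0 ?enorm_ge0// mulVf// enorm_eq0.
have uB : exists B, forall y, `|u y| <= B.
  have [k _ /(_ k (leqnn k)) hk] := unif 1 ltr01.
  have [B hB] := bounded_fun_norm (bu_ k); exists (B + 1) => y.
  have := hB y; have := hk y; rewrite ltr_norml ler_norml => /andP[h1 h2] /andP[h3 h4].
  by rewrite ler_norml; apply/andP; split; lra.
have := @touching_above R N s alpha s12 C0 alpha_bnd N0 D eps
  (fun k y => - u_ (eps k) y) (fun y => - u y) (fun y => - phi y) x r oD eps0 eps_cvg.
rewrite gradN; last exact: (proj1 phiC2).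
rewrite enormN scalerN oppr_eq0 -/e => key.
suff : 0 <= - L_op s alpha phit x by rewrite oppr_ge0.
apply: le_trans (key _ _ _ _ _ Dx r0 phiNC2 _ grad0 _) _.
- by move=> k; apply: measurableT_comp.
- by move=> k; have [B hB] := bounded_fun_norm (bu_ k); exists B => y; rewrite normrN.
- by move=> k y Dy; rewrite avg_opN// dpp.
- move=> d d0; apply: filterS (unif d d0) => k hk y.
  by rewrite -opprD normrN; exact: hk.
- by move=> y; apply: continuousN; exact: cu.
- by rewrite xE.
- by move=> y xy yx; rewrite ltrN2; exact: contact.
rewrite mu_int_opp_axis//; last first.
  apply: measurable_glued => //.
  by move=> y; apply: continuousN; exact: cu.
rewrite /L_op gradE -/e -[leRHS]mulN1r.
have mT : measurable (cone alpha 0%:E +oo%E e : set (borelR R N)).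
  exact: measurable_cone.
have [B hB] := uB.
rewrite -(mu_intZ _ mT (levy_integrable_second_difference s12 C0 x r0 phiC2 cu hB mT)).
rewrite le_eqVlt; apply/orP; left; apply/eqP; apply: eq_mu_int => z _.
by rewrite !gluedN; ring.
Qed.
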